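(* Let $V=T_{p_0}S$, $m=\dim V$, choose a basis $e_1,\dots,e_m$ of $V$, and let $\Lambda_1,\dots,\Lambda_m$ be continuous linear functionals on the Banach space $\mathcal L(\mathscr H_{p_0}^{k+2,\alpha},\mathscr Y_{p_0}^{k,\alpha})$ containing the Jacobi variations $\mathfrak J_{g_0}(V)$. Form the matrix $B_{ij}=\Lambda_i(\mathfrak J_{g_0}(e_j))$. If $\det B\neq0$, then $\mathfrak J_{g_0}$, and hence $\mathcal D_{g_0}$, is injective. Therefore the chosen Einstein family is infinitesimally observable by the core package, and the finite scalar detection and local reconstruction conclusions apply, namely: for any admissible class $E$ of scalar postprocessings satisfying scalar richness, or for the class of all smooth local scalar postprocessings near $a_0=\mathcal A_{E,\mathrm{core}}(p_0)$, there exist $m$ postprocessings $\psi_1,\dots,\psi_m$ in the class such that $(\psi_1\circ\mathcal A_{E,\mathrm{core}},\dots,\psi_m\circ\mathcal A_{E,\mathrm{core}})$ has injective differential at $p_0$ and is, after shrinking $S$ around $p_0$, a local diffeomorphism onto an open subset of $\mathbb R^m$; and, after shrinking $S$ around $p_0$, $\mathcal A_{E,\mathrm{core}}$ is a smooth embedding onto its image, so $p$ is locally determined by its core package. Conversely, if $\mathfrak J_{g_0}$ is injective, then a collection of $m$ continuous linear functionals $\Lambda_1,\dots,\Lambda_m$ with $\det B\ne0$ exists.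
   Context: $M$ is a compact manifold with a smooth cohomogeneity-one action of a Lie group $\mathsf G$ with orbit space a closed interval. A normalized Einstein metric is a $\mathsf G$-invariant metric $g$ with $\operatorname{Ric}(g)=\lambda g$ ($\lambda>0$ fixed), normalized by a fixed unit-speed normal geodesic joining the two singular orbits. A smooth parameterized Einstein family is a smooth finite-dimensional manifold $S$ with normalized Einstein metrics $g_p$, $p\in S$, whose coefficients depend smoothly on $(p,x)\in S\times M$; write $\mathbf g:p\mapsto g_p$ (not assumed immersive), and $g_{p_0}=g_0$. Probe data: a compact Riemannian target $(N,h)$ with compatible $\mathsf G$-action, an equivariant homotopy class of maps $M\to N$, endpoint, smoothness and normalization conditions, and a reference harmonic map $f_0:(M,g_0)\to(N,h)$ satisfying them. Standing smoothness hypotheses: with $k\ge4$, $0<\alpha<1$, the constrained equivariant $C^{k+2,\alpha}$ maps form a smooth Banach manifold $\mathcal H^{k+2,\alpha}$; $\mathcal Y^{k,\alpha}$ is the Banach bundle with fibre over $f$ the equivariant $C^{k,\alpha}$ sections of $f^*TN$; $\mathcal G$ is a Banach manifold of normalized cohomogeneity-one metrics, $\mathbf g:S\to\mathcal G$ is smooth, and $\mathcal F(g,f)=\tau_g(f)$ (tension field) is smooth on $\mathcal G\times\mathcal H^{k+2,\alpha}$ in fixed local trivializations. Normalized Jacobi nondegeneracy (assumed): $J_{g_0}=D_f\mathcal F(g_0,f_0):T_{f_0}\mathcal H^{k+2,\alpha}\to\mathcal Y^{k,\alpha}_{f_0}$ is an isomorphism. By the implicit function theorem, after shrinking $S$ around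 $p_0$, there is a unique smooth map $\Pi_E:S\to\mathcal H^{k+2,\alpha}$, $p\mapsto f_p$, near $f_0$, with $f_{p_0}=f_0$ and $\mathcal F(g_p,f_p)=0$, and $J_p:=D_f\mathcal F(g_p,f_p):\mathscr H_p^{k+2,\alpha}:=T_{f_p}\mathcal H^{k+2,\alpha}\to\mathscr Y_p^{k,\alpha}:=\mathcal Y_{f_p}^{k,\alpha}$ is invertible for all $p$; $G_p:=J_p^{-1}$, $G_0=G_{p_0}$. In fixed smooth local trivializations the spaces are identified with $\mathscr H_{p_0}^{k+2,\alpha},\mathscr Y_{p_0}^{k,\alpha}$, and $J(g,f):=D_f\mathcal F(g,f)$ is a smooth function of $(g,f)$ near $(g_0,f_0)$ with values in $\mathcal L(\mathscr H_{p_0}^{k+2,\alpha},\mathscr Y_{p_0}^{k,\alpha})$. The (descended) core analytical package is the smooth map $\mathcal A_{E,\mathrm{core}}:S\to\mathscr X_{\mathrm{core}}$, $p\mapsto(J_p,G_p)$, where $\mathscr X_{\mathrm{core}}$ is a Banach manifold of operator data; in the trivialization these pairs lie in $\mathcal L(\mathscr H_{p_0}^{k+2,\alpha},\mathscr Y_{p_0}^{k,\alpha})\times\mathcal L(\mathscr Y_{p_0}^{k,\alpha},\mathscr H_{p_0}^{k+2,\alpha})$. The universal response differential is $\mathcal D_{g_0}=D_{p_0}\mathcal A_{E,\mathrm{core}}$; the family is infinitesimally observable by the core package if $\mathcal D_{g_0}$ is injective. The effective Jacobi-response operator $\mathfrak J_{g_0}:V\to\mathcal L(\mathscr H_{p_0}^{k+2,\alpha},\mathscr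 Y_{p_0}^{k,\alpha})$ is $\mathfrak J_{g_0}(X)=D_gJ_{(g_0,f_0)}[h_X]+D_fJ_{(g_0,f_0)}[\dot f_X]$, where $h_X=D\mathbf g_{p_0}[X]$ and $\dot f_X=D(\Pi_E)_{p_0}[X]=-G_0\,D_g\mathcal F(g_0,f_0)[h_X]$. Scalar richness of a Banach space $E$ of smooth functions $\psi:\mathscr X_{\mathrm{core}}\to\mathbb R$ defined near $a_0$: $E$ is continuously embedded in the local $C^1$ postprocessing space and the restriction map $\rho:E\to(\mathcal D_{g_0}(V))^*$, $\rho(\psi)=d\psi_{a_0}|_{\mathcal D_{g_0}(V)}$, is continuous and surjective. *)

(* Defs.v *)
From HB Require Import structures.
From mathcomp Require Import all_boot all_order all_algebra.
From mathcomp Require Import all_classical all_reals all_analysis.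

Set Implicit Arguments.
Unset Strict Implicit.
Unset Printing Implicit Defensive.

Import Order.TTheory GRing.Theory Num.Theory.
Import numFieldNormedType.Exports.

Local Open Scope classical_set_scope.
Local Open Scope ring_scope.

Section BoundedOperators.
Variables (R : realType) (V W : normedModType R).
Implicit Types f g : V -> W.

Definition is_blin f : Prop := linear f /\ continuous f.

Definition blin_pred : {pred (V -> W)} := fun f => `[< is_blin f >].

Record blin := Blin { blin_fun :> V -> W ; blinP : blin_fun \in blin_pred }.

HB.instance Definition _ := [isSub for blin_fun].
HB.instance Definition _ := [Choice of blin by <:].

Lemma blin_submod_closed : submod_closed blin_pred.
Proof.
split=> [|a f g].
  rewrite unfold_in; apply/asboolP; split; last exact: cst_continuous.
  by move=> a x y; rewrite /= scaler0 addr0.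
rewrite !unfold_in => /asboolP[fl fc] /asboolP[gl gc]; apply/asboolP; split.
  move=> b x y.
  rewrite -[LHS]/(a *: f (b *: x + y) + g (b *: x + y)).
  rewrite -[RHS]/(b *: (a *: f x + g x) + (a *: f y + g y)).
  by rewrite fl gl !scalerDr !scalerA (mulrC a b) addrACA.
by move=> x; apply: cvgD; [apply: cvgZl_tmp; exact: fc | exact: gc].
Qed.

HB.instance Definition _ :=
  GRing.isSubmodClosed.Build R (V -> W) blin_pred blin_submod_closed.
HB.instance Definition _ := [SubChoice_isSubLmodule of blin by <:].

Implicit Types S T : blin.

Lemma blin_linear T : linear T.
Proof. by case: T => f /= /[!unfold_in] /asboolP[]. Qed.

Lemma blin_continuous T : continuous T.
Proof. by case: T => f /= /[!unfold_in] /asboolP[]. Qed.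

HB.instance Definition _ T := GRing.isLinear.Build R V W _ T (blin_linear T).

Lemma blin_addE S T x : (S + T) x = S x + T x. Proof. by []. Qed.
Lemma blin_scaleE a T x : (a *: T) x = a *: T x. Proof. by []. Qed.

Definition blin_norm T : R := sup [set `|T x| | x in [set x : V | `|x| <= 1]].

Lemma blin_norm_has_sup T : has_sup [set `|T x| | x in [set x : V | `|x| <= 1]].
Proof.
split; first by exists `|T 0|, 0 => //=; rewrite normr0.
have /linear_boundedP[M [_ HM]] : bounded_near T (nbhs (0 : V)).
  by apply/linear_bounded_continuous; exact: blin_continuous.
exists (`|M| + 1) => _ [x /= x1 <-].
have M1 : M < `|M| + 1 by rewrite ltr_pwDr// ler_norm.
apply: (le_trans (HM _ M1 x)).
by rewrite ger_pMr// ltr_wpDl.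
Qed.

Lemma blin_norm_ge T x : `|x| <= 1 -> `|T x| <= blin_norm T.
Proof.
move=> x1; apply: ub_le_sup; last by exists x.
by case: (blin_norm_has_sup T).
Qed.

Lemma blin_norm_le T (M : R) :
  (forall x, `|x| <= 1 -> `|T x| <= M) -> blin_norm T <= M.
Proof.
move=> TM; apply: ge_sup; first by case: (blin_norm_has_sup T).
by move=> _ [x x1 <-]; exact: TM.
Qed.

Lemma blin_normP T x : `|T x| <= blin_norm T * `|x|.
Proof.
have [->|x0] := eqVneq x 0; first by rewrite linear0 !normr0 mulr0.
rewrite -ler_pdivrMr ?normr_gt0//.
have -> : `|T x| / `|x| = `|T (`|x|^-1 *: x)|.
  by rewrite linearZ normrZ mulrC ger0_norm// invr_ge0.
apply: blin_norm_ge.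
by rewrite normrZ ger0_norm ?invr_ge0// mulVf// normr_eq0.
Qed.

Lemma blin_normD S T : blin_norm (S + T) <= blin_norm S + blin_norm T.
Proof.
apply: blin_norm_le => x x1; rewrite blin_addE.
by rewrite (le_trans (ler_normD _ _))// lerD// blin_norm_ge.
Qed.

Lemma blin_normZ (a : R) T : blin_norm (a *: T) = `|a| * blin_norm T.
Proof.
have le_normZ (b : R) U : blin_norm (b *: U) <= `|b| * blin_norm U.
  apply: blin_norm_le => x x1; rewrite blin_scaleE normrZ.
  by rewrite ler_wpM2l// blin_norm_ge.
apply/eqP; rewrite eq_le le_normZ /=.
have [->|a0] := eqVneq a 0.
  by rewrite normr0 mul0r scale0r (le_trans _ (blin_norm_ge _ (x := 0) _)) ?normr0.
rewrite -ler_pdivlMl ?normr_gt0// -normfV.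
by rewrite -{1}(scale1r T) -(mulVf a0) -scalerA.
Qed.

Lemma blin_norm0_eq0 T : blin_norm T = 0 -> T = 0.
Proof.
move=> T0; apply: val_inj; apply/funext => x /=.
by apply/normr0_eq0/eqP; rewrite eq_le normr_ge0 andbT -(mul0r `|x|) -T0 blin_normP.
Qed.

HB.instance Definition _ :=
  Lmodule_isNormed.Build R blin blin_normD blin_normZ blin_norm0_eq0.

Lemma blin_normE T : `|T| = blin_norm T. Proof. by []. Qed.

End BoundedOperators.

(* The Frechet derivative as a point of the normed space of operators (0 where
   f is not differentiable). *)
Definition dop (R : realType) (V W : normedModType R) (f : V -> W) (x : V) :
  blin V W := insubd (0 : blin V W) ('d f x : V -> W).

(* The following predicates are only used on open sets A. *)
Fixpoint Cn (R : realType) (n : nat) (V W : normedModType R)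
    (A : set V) (f : V -> W) : Prop :=
  match n with
  | 0%N => forall x, A x -> {for x, continuous f}
  | n'.+1 => (forall x, A x -> differentiable f x) /\ Cn n' A (dop f)
  end.

Definition smooth_on (R : realType) (V W : normedModType R)
    (A : set V) (f : V -> W) : Prop := forall n, Cn n A f.

(* All derivatives of order at most n are bounded by c on A, and the n-th one is
   alpha-Hoelder with constant c on A. *)
Fixpoint holder_le (R : realType) (n : nat) (alpha : R) (V W : normedModType R)
    (A : set V) (f : V -> W) (c : R) : Prop :=
  (forall x, A x -> `|f x| <= c) /\
  match n with
  | 0%N => forall x y, A x -> A y -> `|f x - f y| <= c * `|x - y| `^ alpha
  | n'.+1 => holder_le n' alpha A (dop f) c
  end.

Definition Cka (R : realType) (k : nat) (alpha : R) (V W : normedModType R)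
    (A : set V) (f : V -> W) : Prop :=
  Cn k A f /\
  forall x, A x -> exists2 B, nbhs x B & exists c, holder_le k alpha B f c.

Section Charts.
Variable R : realType.

(* An atlas indexed by the points: [chart x] is the preferred chart at x, with
   open domain [cdom x] and inverse [cinv x]. *)
Record charted (E : normedModType R) := Charted {
  pt :> topologicalType;
  cdom : pt -> set pt;
  chart : pt -> pt -> E;
  cinv : pt -> E -> pt }.

Definition ctgt (E : normedModType R) (X : charted E) (x : X) : set E :=
  chart x @` cdom x.

Record manifold (E : normedModType R) := Manifold {
  mfd :> charted E;
  mfd_hausdorff : hausdorff_space mfd;
  mfd_dom_open : forall x : mfd, open (cdom x);
  mfd_dom : forall x : mfd, cdom x x;
  mfd_tgt_open : forall x : mfd, open (ctgt x);
  mfd_chartK : forall x y : mfd, cdom x y -> cinv x (chart x y) = y;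
  mfd_chart_cont : forall x y : mfd, cdom x y -> {for y, continuous (chart x)};
  mfd_cinv_cont : forall (x : mfd) u, ctgt x u -> {for u, continuous (cinv x)};
  mfd_smooth : forall x y : mfd,
    smooth_on (ctgt x `&` cinv x @^-1` cdom y) (chart y \o cinv x) }.

Record fmanifold (n : nat) := FManifold {
  fmfd :> manifold 'rV[R]_n;
  fmfd_countable : @second_countable fmfd }.

Definition vchart (E : normedModType R) : charted E :=
  @Charted E E (fun=> setT) (fun=> id) (fun=> id).

Definition prodc (E F : normedModType R) (X : charted E) (Y : charted F) :
    charted (E * F)%type :=
  @Charted (E * F)%type (X * Y)%type
    (fun z => cdom z.1 `*` cdom z.2)
    (fun z w => (chart z.1 w.1, chart z.2 w.2))
    (fun z u => (cinv z.1 u.1, cinv z.2 u.2)).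

Section Maps.
Variables (E F : normedModType R) (X : charted E) (Y : charted F).

(* only used for open U *)
Definition map_of_class (P : set E -> (E -> F) -> Prop) (U : set X)
    (f : X -> Y) : Prop :=
  (forall x, U x -> {for x, continuous f}) /\
  forall x y, P (ctgt x `&` cinv x @^-1` (U `&` f @^-1` cdom y))
                (chart y \o f \o cinv x).

Definition smooth_map : set X -> (X -> Y) -> Prop :=
  map_of_class (@smooth_on R E F).

Definition Cka_map (k : nat) (alpha : R) : (X -> Y) -> Prop :=
  map_of_class (@Cka R k alpha E F) setT.

(* The tangent space at a point is the model space, a vector being given by its
   coordinates in the preferred chart at that point. *)
Definition tmap (f : X -> Y) (x : X) : {linear E -> F} :=
  'd (chart (f x) \o f \o cinv x) (chart x x).

End Maps.

(* coordinates, in the chart at x0, of a tangent vector at x *)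
Definition tcoord (E : normedModType R) (X : charted E) (x0 x : X) :
  {linear E -> E} := 'd (chart x0 \o cinv x) (chart x x).

End Charts.

Arguments vchart {R} E.
Arguments smooth_map {R E F} X Y U f.
Arguments Cka_map {R E F} X Y k alpha f.
Arguments tmap {R E F X Y} f x.

Section Actions.
Variable R : realType.

Record lie_group := LieGroup {
  lie_dim : nat;
  lie :> fmanifold R lie_dim;
  lmul : lie -> lie -> lie;
  lone : lie;
  linv : lie -> lie;
  lmulA : forall a b c, lmul a (lmul b c) = lmul (lmul a b) c;
  lmul1 : forall a, lmul lone a = a;
  lmulV : forall a, lmul (linv a) a = lone;
  lmul_smooth : smooth_map (prodc lie lie) lie setT (fun z => lmul z.1 z.2);
  linv_smooth : smooth_map lie lie setT linv }.

Variable G : lie_group.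

Record action (n : nat) (M : fmanifold R n) := Action {
  act :> G -> M -> M;
  act1 : forall x, act (lone G) x = x;
  actM : forall a b x, act (lmul a b) x = act a (act b x);
  act_smooth : smooth_map (prodc G M) M setT (fun z => act z.1 z.2) }.

(* x |-> a x, and its differential at the identity in the variable a, whose
   range is the tangent space of the orbit of x *)
Definition orbit_tangent (n : nat) (M : fmanifold R n) (aM : action M) (x : M) :
  {linear 'rV[R]_(lie_dim G) -> 'rV[R]_n} := tmap (fun a : G => aM a x) (lone G).

(* q identifies the orbit space, with the quotient topology, with [0, 1]; the
   orbits over the interior have codimension one. *)
Record cohomogeneity_one (n : nat) (M : fmanifold R n) (aM : action M)
    (q : M -> R) : Prop := CohomogeneityOne {
  coh_orbit : forall x y, q x = q y <-> exists a, y = aM a x;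
  coh_range : range q = [set t : R | 0 <= t <= 1];
  coh_continuous : continuous q;
  coh_quotient : forall A : set R, A `<=` [set t : R | 0 <= t <= 1] ->
    open (q @^-1` A) ->
    exists2 O : set R, open O & A = O `&` [set t : R | 0 <= t <= 1];
  coh_codim : forall x, 0 < q x < 1 ->
    (\rank (lin1_mx (orbit_tangent aM x))).+1 = n }.

End Actions.

Section Metrics.
Variables (R : realType) (n : nat).

Definition ei (i : 'I_n) : 'rV[R]_n := delta_mx 0 i.

Definition pd (i : 'I_n) (f : 'rV[R]_n -> R) (u : 'rV[R]_n) : R :=
  'D_(ei i) f u.

Section Local.
Variable g : 'rV[R]_n -> 'M[R]_n.

(* Gamma^k_{ij} *)
Definition christoffel (k i j : 'I_n) (u : 'rV[R]_n) : R :=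
  2^-1 * \sum_l invmx (g u) k l *
    (pd i (fun w => g w j l) u + pd j (fun w => g w i l) u
     - pd l (fun w => g w i j) u).

Definition ricci (i j : 'I_n) (u : 'rV[R]_n) : R :=
  \sum_k (pd k (christoffel k i j) u - pd j (christoffel k i k) u
    + \sum_l (christoffel k k l u * christoffel l i j u
              - christoffel k j l u * christoffel l i k u)).
End Local.

Variable M : fmanifold R n.

(* a field of bilinear forms, by its matrix at x in the preferred chart at x *)
Definition tensor2 := M -> 'M[R]_n.
Implicit Type g : tensor2.

Definition mform g (x : M) (v w : 'rV[R]_n) : R := (v *m g x *m w^T) 0 0.

(* the coefficients of g in the chart at x0 *)
Definition coef g (x0 : M) (u : 'rV[R]_n) : 'M[R]_n :=
  let x := cinv x0 u in
  let T : 'rV[R]_n -> 'rV[R]_n := 'd (chart x \o cinv x0) u in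
  \matrix_(i, j) mform g x (T (ei i)) (T (ei j)).

Definition riemannian g : Prop := forall x,
  (g x)^T = g x /\ forall v, v != 0 -> 0 < mform g x v v.

Definition smooth_metric g : Prop :=
  riemannian g /\ forall x0, smooth_on (ctgt x0) (coef g x0).

Definition Cka_metric (k : nat) (alpha : R) g : Prop :=
  riemannian g /\ forall x0, Cka k alpha (ctgt x0) (coef g x0).

Definition invariant_metric (G : lie_group R) (aM : action G M) g : Prop :=
  forall a x v w,
    mform g (aM a x) (tmap (aM a) x v) (tmap (aM a) x w) = mform g x v w.

Definition einstein (lambda : R) g : Prop := forall x i j,
  ricci (coef g x) i j (chart x x) = lambda * g x i j.

Definition velocity (gam : R -> M) (t : R) : 'rV[R]_n :=
  tmap (gam : vchart R -> M) t (1 : R).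

Definition geodesic_at g (gam : R -> M) (t : R) : Prop :=
  let c (i : 'I_n) : R -> R := fun s => chart (gam t) (gam s) 0 i in
  forall k, derive1n 2 (c k) t
    + \sum_i \sum_j christoffel (coef g (gam t)) k i j (chart (gam t) (gam t))
        * derive1 (c i) t * derive1 (c j) t = 0.

Definition unit_normal_geodesic (G : lie_group R) (aM : action G M) g
    (gam : R -> M) (L : R) : Prop := forall t, 0 <= t <= L ->
  [/\ geodesic_at g gam t,
      mform g (gam t) (velocity gam t) (velocity gam t) = 1
    & forall xi, mform g (gam t) (velocity gam t)
                   (orbit_tangent aM (gam t) xi) = 0].

Definition joins_ends (q : M -> R) (gam : R -> M) (L : R) : Prop :=
  [/\ 0 < L, smooth_map (vchart R) M setT (gam : vchart R -> M),
      q (gam 0) = 0 & q (gam L) = 1].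

End Metrics.

Section Tension.
Variables (R : realType) (n q : nat) (M : fmanifold R n) (N : fmanifold R q).

(* the tension field, at each x in the preferred charts at x and f x *)
Definition tension (g : tensor2 M) (h : tensor2 N) (f : M -> N) (x : M) :
    'rV[R]_q :=
  let F (c : 'I_q) : 'rV[R]_n -> R :=
    fun u => chart (f x) (f (cinv x u)) 0 c in
  let u := chart x x in let y := chart (f x) (f x) in
  \row_c \sum_i \sum_j invmx (coef g x u) i j *
    (pd i (pd j (F c)) u
     - \sum_k christoffel (coef g x) k i j u * pd k (F c) u
     + \sum_a \sum_b christoffel (coef h (f x)) c a b y
         * pd i (F a) u * pd j (F b) u).

End Tension.

(* The regularity C^{k+1,alpha} is the one for which the tension field of a
   C^{k+2,alpha} map is of class C^{k,alpha}. *)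
Record metric_manifold (R : realType) (n : nat) (M : fmanifold R n)
    (G : lie_group R) (aM : action G M) (gam : R -> M) (L : R)
    (k : nat) (alpha : R) := MetricManifold {
  mm_model : completeNormedModType R;
  mm :> manifold mm_model;
  met : mm -> tensor2 M;
  met_inj : injective met;
  met_Cka : forall g, Cka_metric k.+1 alpha (met g);
  met_invariant : forall g, invariant_metric aM (met g);
  met_normalized : forall g, unit_normal_geodesic aM (met g) gam L;
  met_eval_smooth : forall x,
    smooth_map mm (vchart 'M[R]_n) setT (fun g => met g x) }.

Section Equivariant.
Variables (R : realType) (n q : nat) (M : fmanifold R n) (N : fmanifold R q).
Variables (G : lie_group R) (aM : action G M) (aN : action G N).
Variables (k : nat) (alpha : R).

Definition equivariant (f : M -> N) : Prop :=
  forall a x, f (aM a x) = aN a (f x).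

Definition equiv_homotopic (f f' : M -> N) : Prop :=
  exists Phi : R * M -> N,
    [/\ {within [set t : R | 0 <= t <= 1] `*` setT, continuous Phi},
        forall t, 0 <= t <= 1 -> equivariant (fun x => Phi (t, x)),
        forall x, Phi (0, x) = f x & forall x, Phi (1, x) = f' x].

(* A compact set in a chart of M at [wx], mapped into a chart of N at [wy];
   C^{k,alpha} neighbourhoods are given by Hoelder estimates over finitely many
   such sets. *)
Record window := Window { wx : M; wy : N; wK : set 'rV[R]_n }.

Definition window_at (f : M -> N) (w : window) : Prop :=
  [/\ compact (wK w), wK w `<=` ctgt (wx w)
    & forall u, wK w u -> cdom (wy w) (f (cinv (wx w) u))].

Definition map_close (f f' : M -> N) (w : window) (eps : R) : Prop :=
  (forall u, wK w u -> cdom (wy w) (f' (cinv (wx w) u))) /\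
  holder_le k alpha (wK w)
    (fun u => chart (wy w) (f' (cinv (wx w) u))
              - chart (wy w) (f (cinv (wx w) u))) eps.

(* A section sigma of f^*TN is given at x by the coordinates of sigma x in the
   preferred chart at f x. *)
Definition sec_coord (f : M -> N) (sigma : M -> 'rV[R]_q) (x0 : M) (y0 : N)
    (u : 'rV[R]_n) : 'rV[R]_q :=
  let x := cinv x0 u in tcoord y0 (f x) (sigma x).

Definition sections (f : M -> N) : set (M -> 'rV[R]_q) :=
  [set sigma | (forall x0 y0,
                  Cka k alpha (ctgt x0 `&` cinv x0 @^-1` (f @^-1` cdom y0))
                      (sec_coord f sigma x0 y0))
             /\ (forall a x, sigma (aM a x) = tmap (aN a) (f x) (sigma x))].

(* a topological isomorphism from the space of sections, with its C^{k,alpha}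
   topology, onto a normed space *)
Definition sections_iso (f : M -> N) (Y : normedModType R)
    (theta : (M -> 'rV[R]_q) -> Y) : Prop :=
  [/\ forall b s t, sections f s -> sections f t ->
        theta (fun x => b *: s x + t x) = b *: theta s + theta t,
      forall y, exists! s, sections f s /\ theta s = y,
      exists (r : nat) (w : 'I_r -> window) (c : R),
        (forall i, window_at f (w i)) /\
        forall s eps, sections f s ->
          (forall i, holder_le k alpha (wK (w i))
                       (sec_coord f s (wx (w i)) (wy (w i))) eps) ->
          `|theta s| <= c * eps
    & forall w, window_at f w -> exists c, forall s, sections f s ->
        holder_le k alpha (wK w) (sec_coord f s (wx w) (wy w))
          (c * `|theta s|)].

(* [rep] represents the equivariant homotopy class; [cond] collects the endpoint,
   smoothness and normalization conditions. *)
Definition constrained (cond : set (M -> N)) (rep f : M -> N) : Prop :=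
  [/\ Cka_map M N k alpha f, equivariant f, equiv_homotopic rep f & cond f].

(* The topology is the C^{k,alpha} one; [mapof_tangent] makes the tangent vectors
   at f vector fields along f. *)
Record map_manifold (cond : set (M -> N)) (rep : M -> N) := MapManifold {
  mp_model : completeNormedModType R;
  mp :> manifold mp_model;
  mapof : mp -> M -> N;
  mapof_inj : injective mapof;
  mapof_range : range mapof = constrained cond rep;
  mapof_nbhs : forall (f : mp) (P : set mp), nbhs f P <->
    exists (r : nat) (w : 'I_r -> window) (eps : R),
      [/\ 0 < eps, forall i, window_at (mapof f) (w i)
        & forall f', (forall i, map_close (mapof f) (mapof f') (w i) eps) ->
            P f'];
  mapof_eval_smooth : forall x, smooth_map mp N setT (fun f => mapof f x);
  mapof_tangent : forall (f : mp) (v : mp_model),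
    (forall x, tmap (fun f' : mp => mapof f' x) f v = 0) -> v = 0 }.

End Equivariant.

(* A Banach bundle over a manifold of maps, with fibre over f the sections of
   class C^{k,alpha} of f^*TN; [triv f] is a local trivialization around f. *)
Record section_bundle (R : realType) (n q : nat) (M : fmanifold R n)
    (N : fmanifold R q) (G : lie_group R) (aM : action G M) (aN : action G N)
    (k : nat) (alpha : R) (E : normedModType R) (H : manifold E)
    (mapH : H -> M -> N) := SectionBundle {
  sb_model : completeNormedModType R;
  tdom : H -> set H;
  triv : H -> H -> (M -> 'rV[R]_q) -> sb_model;
  tdom_open : forall f, open (tdom f);
  tdom_in : forall f, tdom f f;
  triv_iso : forall f f', tdom f f' ->
    sections_iso aM aN k alpha (mapH f') (triv f f');
  triv_smooth : forall f1 f2, exists2 T : H -> blin sb_model sb_model,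
    smooth_map H (vchart (blin sb_model sb_model)) (tdom f1 `&` tdom f2) T
    & forall f s, tdom f1 f -> tdom f2 f ->
        sections aM aN k alpha (mapH f) s -> triv f2 f s = T f (triv f1 f s) }.

Definition blin_iso (R : realType) (V W : normedModType R) (T : blin V W) :
  Prop := exists T' : blin W V, cancel T T' /\ cancel T' T.

Definition blin_inv (R : realType) (V W : normedModType R) (T : blin V W) :
  blin W V := xget 0 [set T' : blin W V | cancel T T' /\ cancel T' T].

Section Core.
Variables (R : realType) (n q : nat) (M : fmanifold R n) (N : fmanifold R q).
Variables (G : lie_group R) (aM : action G M) (aN : action G N).
Variables (h : tensor2 N) (gam : R -> M) (L : R) (k : nat) (alpha : R).
Variables (GG : metric_manifold aM gam L k alpha).
Variables (cond : set (M -> N)) (rep : M -> N).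
Variables (HH : map_manifold aM aN k.+2 alpha cond rep).
Variables (YY : section_bundle aM aN k alpha (@mapof _ _ _ _ _ _ _ _ _ _ _ _ HH)).

Definition Ften (g : GG) (f : HH) : M -> 'rV[R]_q :=
  tension (met g) h (mapof f).

(* F in the charts at g1, f1 and the trivialization at f1 *)
Definition Floc (g1 : GG) (f1 : HH) (w : mm_model GG * mp_model HH) :
    sb_model YY :=
  triv YY f1 (cinv f1 w.2) (Ften (cinv g1 w.1) (cinv f1 w.2)).

Definition F_smooth : Prop :=
  (forall g f, sections aM aN k alpha (mapof f) (Ften g f)) /\
  forall (g1 : GG) (f1 : HH),
    smooth_on (ctgt g1 `*` (ctgt f1 `&` cinv f1 @^-1` tdom YY f1))
      (Floc g1 f1).

Definition opJ := blin (mp_model HH) (sb_model YY).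
Definition opG := blin (sb_model YY) (mp_model HH).

(* D_f F, in the charts and trivialization at g0, f0; where F(g, f) = 0 this is
   the vertical derivative, read in the trivialization. *)
Definition Jloc (g0 : GG) (f0 : HH) (u : mm_model GG) (v : mp_model HH) : opJ :=
  dop (fun v' => Floc g0 f0 (u, v')) v.

Definition jacobi (g0 : GG) (f0 : HH) (g : GG) (f : HH) : opJ :=
  Jloc g0 f0 (chart g0 g) (chart f0 f).

Variables (m : nat) (S : fmanifold R m).

Definition smooth_family (gS : S -> GG) : Prop := forall (p1 : S) (x0 : M),
  smooth_on (ctgt p1 `*` ctgt x0)
    (fun w : 'rV[R]_m * 'rV[R]_n => coef (met (gS (cinv p1 w.1))) x0 w.2).

Variables (gS : S -> GG) (p0 : S) (f0 : HH).

(* S0 is the shrunk parameter manifold and [Pi] the branch of harmonic maps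
   given by the implicit function theorem. *)
Record harmonic_branch (S0 : set S) (Pi : S -> HH) : Prop := HarmonicBranch {
  hb_open : open S0;
  hb_in : S0 p0;
  hb_smooth : smooth_map S HH S0 Pi;
  hb_base : Pi p0 = f0;
  hb_harmonic : forall p, S0 p -> Ften (gS p) (Pi p) = cst 0;
  hb_unique : exists2 W : set HH, nbhs f0 W & forall p, S0 p ->
    W (Pi p) /\ forall f, W f -> Ften (gS p) f = cst 0 -> f = Pi p;
  hb_dom : forall p, S0 p ->
    [/\ cdom (gS p0) (gS p), cdom f0 (Pi p) & tdom YY f0 (Pi p)];
  hb_iso : forall p, S0 p -> blin_iso (jacobi (gS p0) f0 (gS p) (Pi p)) }.

Variable Pi : S -> HH.

Definition Xcore : normedModType R := (opJ * opG)%type.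

Definition core_package (p : S) : Xcore :=
  let J := jacobi (gS p0) f0 (gS p) (Pi p) in (J, blin_inv J).

Definition universal_response : 'rV[R]_m -> Xcore :=
  tmap (core_package : S -> vchart Xcore) p0.

Definition jacobi_response (X : 'rV[R]_m) : opJ :=
  let hX := tmap gS p0 X in
  let fX := tmap Pi p0 X in
  let u0 := chart (gS p0) (gS p0) in
  let v0 := chart f0 f0 in
  'd (fun u => Jloc (gS p0) f0 u v0) u0 hX
  + 'd (fun v => Jloc (gS p0) f0 u0 v) v0 fX.

Definition infinitesimally_observable : Prop := injective universal_response.

End Core.

Section Postprocessing.
Variables (R : realType) (X : normedModType R) (a0 : X).

Definition local_smooth_scalar (psi : X -> R) : Prop :=
  exists2 U : set X, open U /\ U a0 & smooth_on U psi.

(* A Banach space of functions, smooth on an open neighbourhood U of a0, that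
   embeds continuously in C^1(U) and restricts onto the dual of the subspace D. *)
Record rich_class (D : set X) := RichClass {
  rc_space : completeNormedModType R;
  rc_fun : rc_space -> X -> R;
  rc_dom : set X;
  rc_open : open rc_dom;
  rc_in : rc_dom a0;
  rc_smooth : forall psi, smooth_on rc_dom (rc_fun psi);
  rc_linear : forall b s t x, rc_dom x ->
    rc_fun (b *: s + t) x = b * rc_fun s x + rc_fun t x;
  rc_inj : forall s t,
    (forall x, rc_dom x -> rc_fun s x = rc_fun t x) -> s = t;
  rc_C1 : exists c : R, forall psi x, rc_dom x ->
    `|rc_fun psi x| <= c * `|psi| /\ `|dop (rc_fun psi) x| <= c * `|psi|;
  rc_restr_continuous : exists c : R, forall psi x, D x ->
    `|'d (rc_fun psi) a0 x| <= c * `|psi| * `|x|;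
  rc_restr_surjective : forall l : X -> R,
    (forall b x y, D x -> D y -> l (b *: x + y) = b * l x + l y) ->
    (exists c : R, forall x, D x -> `|l x| <= c * `|x|) ->
    exists psi, forall x, D x -> 'd (rc_fun psi) a0 x = l x }.

Definition rich_scalar (D : set X) (E : rich_class D) (psi : X -> R) : Prop :=
  exists s : rc_space E, psi = rc_fun s.

Variables (m : nat) (S : fmanifold R m) (p0 : S) (A : S -> X).

Definition diffeo_onto_open (S1 : set S) (Psi : S -> 'rV[R]_m) : Prop :=
  [/\ open (Psi @` S1), smooth_map S (vchart 'rV[R]_m) S1 Psi
    & exists2 theta : 'rV[R]_m -> S,
        smooth_map (vchart 'rV[R]_m) S (Psi @` S1) theta
        & forall p, S1 p -> theta (Psi p) = p].

(* m members of the class whose composites with A have injective differential at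
   p0 and, near p0, form a diffeomorphism onto an open subset of R^m *)
Definition detected_by (cls : (X -> R) -> Prop) (S0 : set S) : Prop :=
  exists psi : 'I_m -> X -> R,
    let Psi (p : S) : 'rV[R]_m := \row_i psi i (A p) in
    [/\ forall i, cls (psi i),
        injective (tmap (Psi : S -> vchart 'rV[R]_m) p0)
      & exists2 S1 : set S, [/\ open S1, S1 p0 & S1 `<=` S0]
          & diffeo_onto_open S1 Psi].

Definition smooth_embedding (S1 : set S) : Prop :=
  [/\ smooth_map S (vchart X) S1 A,
      forall p, S1 p -> injective (tmap (A : S -> vchart X) p),
      {in S1 &, injective A}
    & forall p (P : set S), S1 p -> nbhs p P ->
        exists2 Q : set X, nbhs (A p) Q
          & forall p', S1 p' -> Q (A p') -> P p'].

Definition locally_embedded (S0 : set S) : Prop :=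
  exists2 S1 : set S, [/\ open S1, S1 p0 & S1 `<=` S0] & smooth_embedding S1.

End Postprocessing.

(* Main.v *)
(** The core package is a smooth map, because inversion of operators is smooth
    along any smooth family of invertible ones, and the first component of its
    differential is, by the chain rule, the effective Jacobi response J. If the
    matrix of the Lambda_i against J has nonzero determinant, the scalars
    Lambda_i o fst, or any scalars with the same differentials on the range of
    the response differential, composed with the core package have an
    invertible Jacobian at p0, so the inverse function theorem makes them local
    coordinates; a map through which local coordinates factor is an embedding.
    Conversely, evaluations of sections at points are continuous functionals
    separating the operators, so that m functionals whose matrix against an
    injective J is invertible can be chosen one at a time. *)

Require Import Defs.
From HB Require Import structures.
From mathcomp Require Import all_boot all_order all_algebra.
From mathcomp Require Import all_classical all_reals all_analysis.
From mathcomp Require Import lra.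

Set Implicit Arguments.
Unset Strict Implicit.
Unset Printing Implicit Defensive.

Import Order.TTheory GRing.Theory Num.Theory.
Import numFieldNormedType.Exports.

Local Open Scope classical_set_scope.
Local Open Scope ring_scope.

(** * Bounded linear maps *)

Section BoundedLinearMaps.
Variable R : realType.

Lemma is_blin_bounded (V W : normedModType R) (f : V -> W) (c : R) :
  linear f -> (forall x, `|f x| <= c * `|x|) -> is_blin f.
Proof.
move=> fl fc; split=> //.
pose fL := GRing.isLinear.Build R V W *:%R f fl.
pose F : {linear V -> W} := HB.pack f fL.
apply: (@bounded_linear_continuous _ _ _ F).
apply/linear_boundedP; exists c; split; first exact: num_real.
by move=> r /ltW cr x; apply: le_trans (fc x) _; exact: ler_wpM2r.
Qed.

Definition mkblin (V W : normedModType R) (f : V -> W) (c : R)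
    (fl : linear f) (fc : forall x, `|f x| <= c * `|x|) : blin V W :=
  Blin (asboolT (is_blin_bounded fl fc)).

Lemma blin_ext (V W : normedModType R) (S T : blin V W) : S =1 T -> S = T.
Proof. by move=> ST; apply: val_inj; apply/funext. Qed.

Lemma blin_ge (V W : normedModType R) (T : blin V W) x :
  `|T x| <= `|T| * `|x|.
Proof. exact: blin_normP. Qed.

Lemma blin_le (V W : normedModType R) (T : blin V W) (c : R) : 0 <= c ->
  (forall x, `|T x| <= c * `|x|) -> `|T| <= c.
Proof.
move=> c0 Tc; apply: blin_norm_le => x x1; apply: le_trans (Tc x) _.
by rewrite ler_piMr.
Qed.

Variables U V W X : normedModType R.

Fact bcomp_linear (T : blin V W) (S : blin U V) : linear (T \o S).
Proof. by move=> a x y /=; rewrite !linearP. Qed.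

Fact bcomp_bound (T : blin V W) (S : blin U V) x :
  `|(T \o S) x| <= `|T| * `|S| * `|x|.
Proof.
by apply: le_trans (blin_ge _ _) _; rewrite -mulrA ler_wpM2l// blin_ge.
Qed.

Definition bcomp (T : blin V W) (S : blin U V) : blin U W :=
  mkblin (bcomp_linear T S) (bcomp_bound T S).

Lemma bcomp_norm T S : `|bcomp T S| <= `|T| * `|S|.
Proof. by apply: blin_le => [|x]; rewrite ?mulr_ge0//; exact: bcomp_bound. Qed.

Fact bcompl_linear (T : blin V W) : linear (bcomp T).
Proof. by move=> a S S'; apply: blin_ext => x; rewrite /= linearP. Qed.

Definition bcompl (T : blin V W) : blin (blin U V) (blin U W) :=
  mkblin (bcompl_linear T) (bcomp_norm T).

Fact bcomps_linear : linear bcompl.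
Proof. by move=> a T T'; do 2 apply: blin_ext => ?. Qed.

Fact bcomps_bound T : `|bcompl T| <= 1 * `|T|.
Proof. by rewrite mul1r; apply: blin_le => // S; exact: bcomp_norm. Qed.

(** Composition is a bounded bilinear map, in curried form. The chain rule and the derivative of
    inversion thereby become bilinear expressions to which [Cn_bilin] applies. *)
Definition bcomps : blin (blin V W) (blin (blin U V) (blin U W)) :=
  mkblin bcomps_linear bcomps_bound.

Section Flip.
Variable b : blin U (blin V W).

Lemma bilin_ge x y : `|b x y| <= `|b| * `|x| * `|y|.
Proof.
by apply: le_trans (blin_ge _ _) _; rewrite ler_wpM2r// blin_ge.
Qed.

Fact flip1_linear y : linear (fun x => b x y).
Proof. by move=> a x x'; rewrite linearP. Qed.

Fact flip1_bound y x : `|b x y| <= `|b| * `|y| * `|x|.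
Proof. by rewrite mulrAC bilin_ge. Qed.

Definition flip1 y : blin U W := mkblin (flip1_linear y) (flip1_bound y).

Fact flip_linear : linear flip1.
Proof. by move=> a y y'; apply: blin_ext => x; rewrite /= linearP. Qed.

Fact flip_bound y : `|flip1 y| <= `|b| * `|y|.
Proof. by apply: blin_le => [|x]; rewrite ?mulr_ge0//; exact: flip1_bound. Qed.

(** Exchanges the arguments of a bilinear map. In particular [flip (bcomps _ _ _) S] is
    precomposition with [S], as a bounded operator. *)
Definition flip : blin V (blin U W) := mkblin flip_linear flip_bound.

End Flip.

Fact bid_linear : linear (@idfun V). Proof. by []. Qed.
Fact bid_bound (x : V) : `|x| <= 1 * `|x|. Proof. by rewrite mul1r. Qed.
Definition bid : blin V V := mkblin bid_linear bid_bound.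

Fact binl_linear : linear (fun x : V => (x, 0 : W)).
Proof.
by move=> a x y; rewrite -[RHS]/(a *: x + y, a *: 0 + 0) scaler0 addr0.
Qed.
Fact binl_bound (x : V) : `|(x, 0 : W)| <= 1 * `|x|.
Proof. by rewrite mul1r prod_normE/= normr0 ge_max lexx normr_ge0. Qed.
Definition binl : blin V (V * W)%type := mkblin binl_linear binl_bound.

Fact binr_linear : linear (fun x : W => (0 : V, x)).
Proof.
by move=> a x y; rewrite -[RHS]/(a *: 0 + 0, a *: x + y) scaler0 addr0.
Qed.
Fact binr_bound (x : W) : `|(0 : V, x)| <= 1 * `|x|.
Proof. by rewrite mul1r prod_normE/= normr0 ge_max lexx normr_ge0. Qed.
Definition binr : blin W (V * W)%type := mkblin binr_linear binr_bound.

Fact bfst_linear : linear (@fst V W). Proof. by []. Qed.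
Fact bfst_bound (x : V * W) : `|x.1| <= 1 * `|x|.
Proof. by rewrite mul1r prod_normE le_max lexx. Qed.
Definition bfst : blin (V * W)%type V := mkblin bfst_linear bfst_bound.

Fact bsnd_linear : linear (@snd V W). Proof. by []. Qed.
Fact bsnd_bound (x : V * W) : `|x.2| <= 1 * `|x|.
Proof. by rewrite mul1r prod_normE le_max lexx orbT. Qed.
Definition bsnd : blin (V * W)%type W := mkblin bsnd_linear bsnd_bound.

End BoundedLinearMaps.

Arguments bcomps {R} U V W.
Arguments bid {R} V.
Arguments binl {R} V W.
Arguments binr {R} V W.
Arguments bfst {R} V W.
Arguments bsnd {R} V W.

(** * Frechet derivatives *)

Section Frechet.
Variable R : realType.
Implicit Types U V W X : normedModType R.

(** Differentiability as an epsilon estimate, the form in which derivatives are computed below. [T]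
    is a bare function so that both ['d f x] and [dop f x] fit. *)
Definition frechet V W (f : V -> W) (x : V) (T : V -> W) : Prop :=
  forall eps : R, 0 < eps ->
    \forall y \near x, `|f y - f x - T (y - x)| <= eps * `|y - x|.

Lemma frechet_diff V W (f : V -> W) x (T : blin V W) :
  frechet f x T -> is_diff x f T.
Proof.
move=> fT.
have E : f \o shift x = cst (f x) + T +o_ 0 id.
  apply/eqaddoP => eps eps0; have := fT eps eps0.
  rewrite (near_shift 0 x); apply: filterS => h /=.
  by rewrite subr0 addrK /= opprD addrA.
have dT := diff_unique (@blin_continuous _ _ _ T) E.
apply: DiffDef; last exact: dT.
by apply/diff_locallyP; rewrite dT; split => //; exact: blin_continuous.
Qed.

Lemma diff_frechet V W (f : V -> W) x :
  differentiable f x -> frechet f x ('d f x).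
Proof.
move=> /diff_locally/eqaddoP fx eps eps0; have := fx eps eps0.
rewrite (near_shift 0 x); apply: filterS => h /=.
by rewrite !fctE/= subr0 addrK opprD addrA.
Qed.

Lemma dopE V W (f : V -> W) x : differentiable f x -> dop f x =1 'd f x.
Proof.
move=> fx v; rewrite /dop/= insubdK//; apply/asboolP; split; last first.
  exact: diff_continuous.
exact: linearP.
Qed.

Lemma dop_frechet V W (f : V -> W) x :
  differentiable f x -> frechet f x (dop f x).
Proof.
move=> fx eps eps0; have := diff_frechet fx eps0; apply: filterS => y.
by rewrite dopE.
Qed.

Lemma frechet_dop V W (f : V -> W) x (T : blin V W) :
  frechet f x T -> differentiable f x /\ dop f x = T.
Proof.
move=> /frechet_diff[fx dT]; split=> //; apply: blin_ext => v.
by rewrite dopE// dT.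
Qed.

(** A constant factor in the error is absorbed by rescaling [eps]. The divisor is [|c| + 1], which
    is positive for every [c]. *)
Lemma frechetM V W (f : V -> W) x (T : blin V W) (c : R) :
  (forall eps : R, 0 < eps ->
    \forall y \near x, `|f y - f x - T (y - x)| <= c * (eps * `|y - x|)) ->
  frechet f x T.
Proof.
move=> H eps eps0.
have c0 : 0 < `|c| + 1 by rewrite ltr_wpDl.
have := H (eps / (`|c| + 1)) (divr_gt0 eps0 c0); apply: filterS => y.
move=> /le_trans; apply.
apply: (@le_trans _ _ ((`|c| + 1) * (eps / (`|c| + 1) * `|y - x|))).
  apply: ler_wpM2r; first by rewrite !mulr_ge0// ?invr_ge0 ltW.
  by rewrite (le_trans (ler_norm _))// lerDl.
by rewrite mulrA mulrCA divff ?gt_eqF// mulr1.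
Qed.

Lemma frechet_lipschitz V W (f : V -> W) x (T : blin V W) : frechet f x T ->
  \forall y \near x, `|f y - f x| <= (`|T| + 1) * `|y - x|.
Proof.
move=> /(_ 1 ltr01); apply: filterS => y fy.
rewrite -(subrK (T (y - x)) (f y - f x)) (le_trans (ler_normD _ _))//.
by rewrite mulrDl addrC lerD// blin_ge.
Qed.

Lemma near_dop V W (f g : V -> W) x : (\forall y \near x, f y = g y) ->
  differentiable f x -> differentiable g x /\ dop g x = dop f x.
Proof.
move=> fg fx; apply: frechet_dop => eps eps0.
have fgx := nbhs_singleton fg.
by apply: filterS2 fg (dop_frechet fx eps0) => y <-; rewrite -fgx.
Qed.

Lemma is_diff_dop V W (f : V -> W) x (T : blin V W) :
  is_diff x f T -> dop f x = T.
Proof.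
move=> [fx dT]; apply: blin_ext => v.
exact: etrans (dopE fx v) (congr1 (fun F : V -> W => F v) dT).
Qed.

Lemma dop_is_diff V W (f : V -> W) x :
  differentiable f x -> is_diff x f (dop f x).
Proof. by move=> fx; apply: DiffDef => //; apply/funext => v; rewrite dopE. Qed.

Lemma dop_comp U V W (f : U -> V) (g : V -> W) x :
  differentiable f x -> differentiable g (f x) ->
  dop (g \o f) x = bcomp (dop g (f x)) (dop f x).
Proof.
move=> /dop_is_diff fx /dop_is_diff gx.
exact: (is_diff_dop (T := bcomp _ _) (is_diff_comp fx gx)).
Qed.

Lemma blin_differentiable V W (T : blin V W) x : differentiable T x.
Proof. by apply: linear_differentiable; exact: blin_continuous. Qed.

Lemma dop_blin V W (T : blin V W) x : dop T x = T.
Proof.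
have dT : is_diff x T T.
  apply: DiffDef; first exact: blin_differentiable.
  exact: diff_lin (@blin_continuous _ _ _ T).
exact: is_diff_dop dT.
Qed.

Lemma dop_cst V W (a : W) (x : V) : dop (cst a) x = 0.
Proof. exact: (is_diff_dop (T := 0) (is_diff_cst a x)).
 Qed.

Lemma dopD V W (f g : V -> W) x :
  differentiable f x -> differentiable g x ->
  dop (f \+ g) x = dop f x + dop g x.
Proof.
move=> /dop_is_diff fx /dop_is_diff gx.
exact: (is_diff_dop (T := dop f x + dop g x) (is_diffD fx gx)).
Qed.

(** With [u] and [v] the linear parts of the two increments, the error of the product rule is two
    first-order remainders and one cross term. *)
Lemma bilin_increment U V W (b : blin U (blin V W)) (x x' u : U) (y y' v : V) :
  b x' y' - b x y - (b u y + b x v)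
  = b (x' - x - u) y' + b u (y' - y) + b x (y' - y - v).
Proof.
have bB (z z' : U) w : b (z - z') w = b z w - b z' w by rewrite linearB.
rewrite !bB !linearB.
rewrite opprD !addrA subrK (addrAC _ (- b x y') (- b u y)) subrK.
by rewrite (addrAC _ (- b x y) (- b u y)).
Qed.

Lemma frechet_bilin U V W X (b : blin U (blin V W)) (f : X -> U) (g : X -> V)
    x : differentiable f x -> differentiable g x ->
  frechet (fun y => b (f y) (g y)) x
    (bcomp (flip b (g x)) (dop f x) + bcomp (b (f x)) (dop g x)).
Proof.
move=> fx gx.
apply: (@frechetM _ _ _ _ _
  (`|b| * (`|g x| + 1) + `|b| * `|dop f x| + `|b| * `|f x|)) => eps eps0.
(* The bound 1 keeps [g y] bounded in the first error term; the bound [eps] makes the cross term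
   small. *)
have gc : \forall y \near x, `|g y - g x| <= Num.min 1 eps.
  have /cvgrPdist_le := differentiable_continuous gx.
  have m0 : 0 < Num.min 1 eps by rewrite lt_min ltr01.
  by move=> /(_ _ m0); apply: filterS => y; rewrite distrC.
near=> y.
have fy : `|f y - f x - dop f x (y - x)| <= eps * `|y - x|.
  by near: y; exact: dop_frechet.
have gy : `|g y - g x - dop g x (y - x)| <= eps * `|y - x|.
  by near: y; exact: dop_frechet.
have : `|g y - g x| <= Num.min 1 eps by near: y.
rewrite le_min => /andP[g1 geps].
have gyn : `|g y| <= `|g x| + 1.
  by rewrite -(subrK (g x) (g y)) addrC (le_trans (ler_normD _ _))// lerD.
set d := y - x in fy gy *.
have -> : b (f y) (g y) - b (f x) (g x)
    - (bcomp (flip b (g x)) (dop f x) + bcomp (b (f x)) (dop g x)) d =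
    b (f y - f x - dop f x d) (g y) + b (dop f x d) (g y - g x)
    + b (f x) (g y - g x - dop g x d).
  exact: bilin_increment.
rewrite !mulrDl (le_trans (ler_normD _ _))// lerD//.
  rewrite (le_trans (ler_normD _ _))// lerD//.
    rewrite (le_trans (bilin_ge _ _ _))// -!mulrA ler_wpM2l// mulrC.
    by rewrite ler_pM.
  rewrite (le_trans (bilin_ge _ _ _))// -!mulrA ler_wpM2l//.
  by rewrite (mulrC eps) mulrA ler_pM// blin_ge.
rewrite (le_trans (bilin_ge _ _ _))// -!mulrA !ler_wpM2l//.
Unshelve. all: by end_near. Qed.


End Frechet.

(** * Calculus of maps of class C^n *)

Section CnCalculus.
Variable R : realType.
Implicit Types U V W X : normedModType R.

Lemma continuous_near V W (f : V -> W) x (eps : R) : {for x, continuous f} ->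
  0 < eps -> \forall y \near x, `|f y - f x| <= eps.
Proof.
move=> /cvgrPdist_le fx /fx; apply: filterS => y.
by rewrite distrC.
Qed.

Lemma Cn_continuous n V W (A : set V) (f : V -> W) :
  Cn n A f -> forall x, A x -> {for x, continuous f}.
Proof.
by case: n => [//|n] [df _] x Ax; apply: differentiable_continuous; exact: df.
Qed.

Lemma CnW n V W (A : set V) (f : V -> W) : Cn n.+1 A f -> Cn n A f.
Proof.
elim: n V W A f => [|n IH] V W A f; first exact: Cn_continuous.
by move=> [df /IH].
Qed.

Lemma Cn_sub n V W (A B : set V) (f : V -> W) :
  B `<=` A -> Cn n A f -> Cn n B f.
Proof.
move=> BA; elim: n W f => [|n IH] W f; first by move=> fA x /BA; exact: fA.
by move=> [df dfA]; split=> [x /BA|]; [exact: df|exact: IH].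
Qed.

(** On an open set, equality at the points is equality near each point, and so passes to all
    derivatives. *)
Lemma Cn_ext n V W (A : set V) (f g : V -> W) : open A ->
  (forall x, A x -> f x = g x) -> Cn n A f -> Cn n A g.
Proof.
move=> oA; elim: n W f g => [|n IH] W f g fg.
  move=> fA x Ax; have fgx : \forall y \near x, f y = g y.
    by apply: filterS (open_nbhs_nbhs (conj oA Ax)).
  have := fA x Ax; rewrite /prop_for /continuous_at fg//.
  by apply: cvg_trans; exact: near_eq_cvg.
have near_fg x : A x -> \forall y \near x, f y = g y.
  by move=> Ax; apply: filterS (open_nbhs_nbhs (conj oA Ax)).
move=> [df dfA]; have dfg x (Ax : A x) := near_dop (near_fg x Ax) (df x Ax).
split=> [x Ax|]; first exact: (dfg x Ax).1.
by apply: IH dfA => x Ax; exact: esym (dfg x Ax).2.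
Qed.

Lemma Cn_cst n V W (A : set V) (a : W) : open A -> Cn n A (cst a).
Proof.
move=> oA; elim: n W a => [|n IH] W a; last first.
  split=> [x _|]; first exact: differentiable_cst.
  by apply: (Cn_ext oA _ (IH _ 0)) => // x _; exact: esym (dop_cst a x).
by move=> x _; exact: cst_continuous.
Qed.

Lemma Cn_blin n V W (A : set V) (T : blin V W) : open A -> Cn n A T.
Proof.
case: n => [|n] oA; first by move=> x _; exact: blin_continuous.
split=> [x _|]; first exact: blin_differentiable.
by apply: (Cn_ext oA _ (Cn_cst n T oA)) => // x _; exact: esym (dop_blin T x).
Qed.

(** The derivative of [T \o f] is the derivative of [f] followed by the bounded operator [bcompl T],
    so the induction applies to it with new spaces. *)
Lemma Cn_blin_comp n V W X (A : set V) (f : V -> W) (T : blin W X) : open A ->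
  Cn n A f -> Cn n A (T \o f).
Proof.
move=> oA; elim: n W X f T => [|n IH] W X f T.
  move=> fA x Ax.
  exact: continuous_comp (fA x Ax) (@blin_continuous _ _ _ T _).
move=> [df dfA]; split=> [x Ax|].
  by apply: differentiable_comp (df x Ax) (blin_differentiable T _).
apply: (Cn_ext oA _ (IH _ _ _ (bcompl V T) dfA)) => // x Ax.
apply: etrans (esym (dop_comp (df x Ax) (blin_differentiable T _))).
exact: (congr1 (fun S => bcomp S (dop f x)) (esym (dop_blin T (f x)))).
Qed.

Lemma CnD n V W (A : set V) (f g : V -> W) : open A ->
  Cn n A f -> Cn n A g -> Cn n A (f \+ g).
Proof.
move=> oA; elim: n W f g => [|n IH] W f g.
  by move=> fA gA x Ax; apply: cvgD; [exact: fA|exact: gA].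
move=> [df dfA] [dg dgA]; split=> [x Ax|].
  exact: (differentiableD (df x Ax) (dg x Ax)).
apply: (Cn_ext oA _ (IH _ _ _ dfA dgA)) => // x Ax.
exact: esym (dopD (df x Ax) (dg x Ax)).
Qed.

Lemma Cn_sum n V W (A : set V) m (f : 'I_m -> V -> W) : open A ->
  (forall i, Cn n A (f i)) -> Cn n A (fun x => \sum_i f i x).
Proof.
move=> oA fA.
suff H (s : seq 'I_m) : Cn n A (fun x => \sum_(i <- s) f i x).
  by apply: (Cn_ext oA _ (H (index_enum 'I_m))).
elim: s => [|i s IH].
  by apply: (Cn_ext oA _ (Cn_cst n 0 oA)) => // x _; rewrite big_nil.
by apply: (Cn_ext oA _ (CnD oA (fA i) IH)) => // x _; rewrite big_cons.
Qed.

Lemma Cn_pair n V W X (A : set V) (f : V -> W) (g : V -> X) : open A ->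
  Cn n A f -> Cn n A g -> Cn n A (fun x => (f x, g x)).
Proof.
move=> oA fA gA.
have := CnD oA (Cn_blin_comp (binl W X) oA fA) (Cn_blin_comp (binr W X) oA gA).
apply: (Cn_ext oA) => // x _ /=.
by rewrite -[LHS]/(f x + 0, 0 + g x) addr0 add0r.
Qed.

(** The product rule writes the derivative as two terms of the same shape, with [bcomps] as the
    bilinear map. Hence the induction over all spaces and all [b]. *)
Lemma Cn_bilin n U V W X (A : set X) (b : blin U (blin V W))
    (f : X -> U) (g : X -> V) : open A ->
  Cn n A f -> Cn n A g -> Cn n A (fun x => b (f x) (g x)).
Proof.
move=> oA; elim: n U V W b f g => [|n IH] U V W b f g.
  move=> fA gA x Ax.
  (* Joint continuity of [b] comes from its differentiability, which is the product rule applied to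
     the two projections. *)
  pose p := (f x, g x).
  have [bp _] := frechet_dop (frechet_bilin b
    (blin_differentiable (bfst U V) p) (blin_differentiable (bsnd U V) p)).
  exact: (@continuous_comp _ _ _ (fun y => (f y, g y)) _ x
    (cvg_pair (fA x Ax) (gA x Ax)) (differentiable_continuous bp)).
move=> fA gA; have [[df dfA] [dg dgA]] := (fA, gA).
have dfg x (Ax : A x) := frechet_dop (frechet_bilin b (df x Ax) (dg x Ax)).
split=> [x Ax|]; first exact: (dfg x Ax).1.
have fl := Cn_blin_comp (flip b) oA (CnW gA).
have fr := Cn_blin_comp b oA (CnW fA).
have := CnD oA (IH _ _ _ (bcomps _ _ _) _ _ fl dfA)
  (IH _ _ _ (bcomps _ _ _) _ _ fr dgA).
by apply: (Cn_ext oA) => // x Ax; exact: esym (dfg x Ax).2.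
Qed.

(** The chain rule is a bilinear expression in [dop g \o f] and [dop f]. The first is of class C^n
    by induction, since [f] is. *)
Lemma Cn_comp n U V W (A : set U) (B : set V) (f : U -> V) (g : V -> W) :
  open A -> open B -> (forall x, A x -> B (f x)) ->
  Cn n A f -> Cn n B g -> Cn n A (g \o f).
Proof.
move=> oA oB AB; elim: n W g => [|n IH] W g.
  by move=> fA gB x Ax; apply: continuous_comp (fA x Ax) (gB _ (AB _ Ax)).
move=> fA [dg dgB]; have [df dfA] := fA; split=> [x Ax|].
  exact: differentiable_comp (df x Ax) (dg _ (AB _ Ax)).
have := Cn_bilin (bcomps _ _ _) oA (IH _ _ (CnW fA) dgB) dfA.
apply: (Cn_ext oA) => // x Ax.
exact: esym (dop_comp (df x Ax) (dg _ (AB _ Ax))).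
Qed.

(** * Inversion along a family of invertible operators *)

Section Inverse.
Variables (V W X : normedModType R) (F : X -> blin V W) (G : X -> blin W V).

Lemma resolvent x y : cancel (G x) (F x) -> cancel (F y) (G y) ->
  G y - G x = bcomp (G y) (bcomp (F x - F y) (G x)).
Proof.
move=> Gx Gy; apply: blin_ext => w.
by rewrite -[RHS]/(G y (F x (G x w) - F y (G x w))) linearB/= Gx Gy.
Qed.

(* The resolvent identity bounds [G y] by [2 g] near [x]: as the inverses are
   given, no Neumann series, hence no completeness, is needed. *)
Lemma inverse_continuous x : {for x, continuous F} ->
  (\forall y \near x, cancel (F y) (G y)) -> cancel (G x) (F x) ->
  {for x, continuous G}.
Proof.
move=> Fx FG Gx; apply/cvgrPdist_le => eps eps0.
pose g := `|G x| + 1.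
have g0 : 0 < g by rewrite ltr_wpDl.
have gG : `|G x| <= g by rewrite lerDl.
(* The first bound makes [|F x - F y| * g] at most one half, so that [|G y| <= g + |G y| / 2]; the
   second turns the resulting [|G y| <= 2 * g] into the final [eps]. *)
pose e := Num.min (2^-1 / g) (eps / (2 * g * g)).
have e0 : 0 < e by rewrite lt_min !divr_gt0 ?mulr_gt0.
apply: filterS2 FG (continuous_near Fx e0) => y FGy.
rewrite distrC le_min => /andP[].
rewrite ler_pdivlMr// ler_pdivlMr ?mulr_gt0// => F1 F2.
have Ry : `|G y - G x| <= `|G y| * (`|F x - F y| * g).
  rewrite (resolvent Gx FGy) (le_trans (bcomp_norm _ _))// ler_wpM2l//.
  by rewrite (le_trans (bcomp_norm _ _))// ler_wpM2l.
have Gy : `|G y| <= 2 * g.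
  have : `|G y| <= g + `|G y| * 2^-1.
    rewrite -{1}(subrK (G x) (G y)) addrC (le_trans (ler_normD _ _))//.
    by rewrite lerD// (le_trans Ry)// ler_wpM2l.
  lra.
rewrite distrC (le_trans Ry)// (le_trans _ F2)// mulrCA ler_wpM2l// .
by rewrite ler_wpM2r// ltW.
Qed.

(** The derivative is [- G F' G]. By the resolvent identity the error is the first-order remainder
    of [F] between two copies of [G x], plus a product of [G y - G x], which tends to 0, with
    [F y - F x], which is of first order. *)
Lemma frechet_inverse x : differentiable F x ->
  (\forall y \near x, cancel (F y) (G y)) -> cancel (G x) (F x) ->
  frechet G x (- bcomp (bcomp (bcompl W (G x)) (flip (bcomps _ _ _) (G x)))
                      (dop F x)).
Proof.
move=> Fx FG Gx.
have Gc := inverse_continuous (differentiable_continuous Fx) FG Gx.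
apply: (@frechetM _ _ _ _ _ _
  (`|G x| * `|G x| + (`|dop F x| + 1) * `|G x|)) => eps eps0.
near=> y.
have FGy : cancel (F y) (G y) by near: y.
have F1 : `|F y - F x - dop F x (y - x)| <= eps * `|y - x|.
  by near: y; exact: dop_frechet.
have F2 : `|F y - F x| <= (`|dop F x| + 1) * `|y - x|.
  by near: y; apply: frechet_lipschitz; exact: dop_frechet.
have G1 : `|G y - G x| <= eps.
  by near: y; exact: continuous_near.
set d := y - x in F1 F2 *.
have -> : G y - G x - (- bcomp (bcomp (bcompl W (G x))
      (flip (bcomps _ _ _) (G x))) (dop F x)) d =
    - bcomp (G x) (bcomp (F y - F x - dop F x d) (G x))
    - bcomp (G y - G x) (bcomp (F y - F x) (G x)).
  apply: blin_ext => w.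
  rewrite -[LHS]/(G y w - G x w - - (G x (dop F x d (G x w)))).
  rewrite -[RHS]/(- G x (F y (G x w) - F x (G x w) - dop F x d (G x w))
    - (G y (F y (G x w) - F x (G x w)) - G x (F y (G x w) - F x (G x w)))).
  move: (dop F x d (G x w)) => u.
  rewrite !linearB/= Gx FGy.
  move: (G x u) (G y w) (G x w) => b c e; move: (G x (F y e)) => a.
  rewrite !opprK !addrA (addrAC _ b) addrK (addrC (- a)) (addrAC b) subrK.
  by rewrite addrAC (addrC c).
rewrite (le_trans (ler_normB _ _))// normrN mulrDl lerD//.
  rewrite (le_trans (bcomp_norm _ _))// -mulrA ler_wpM2l//.
  by rewrite (le_trans (bcomp_norm _ _))// mulrC ler_wpM2l.
rewrite (le_trans (bcomp_norm _ _))//.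
rewrite mulrCA ler_pM// (le_trans (bcomp_norm _ _))//.
by rewrite mulrAC ler_wpM2r.
Unshelve. all: by end_near. Qed.

End Inverse.

(** Bootstrapping: the formula [- G F' G] contains [G] undifferentiated, so each class reached by
    [G] is reached by its derivative too, as far as that of [F] allows. *)
Lemma Cn_inverse n V W X (A : set X) (F : X -> blin V W) (G : X -> blin W V) :
  open A -> (forall x, A x -> cancel (F x) (G x) /\ cancel (G x) (F x)) ->
  Cn n A F -> Cn n A G.
Proof.
move=> oA FG.
have nFG x : A x -> \forall y \near x, cancel (F y) (G y).
  move=> Ax; apply: filterS (open_nbhs_nbhs (conj oA Ax)) => y Ay.
  by case: (FG y Ay).
elim: n => [FA x Ax|n IH FA].
  exact: inverse_continuous (FA x Ax) (nFG x Ax) (FG x Ax).2.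
have [dF dFA] := FA; have {IH} GA := IH (CnW FA).
have dG x (Ax : A x) :=
  frechet_dop (frechet_inverse (dF x Ax) (nFG x Ax) (FG x Ax).2).
split=> [x Ax|]; first exact: (dG x Ax).1.
have l1 := Cn_blin_comp (bcomps W W V) oA GA.
have l2 := Cn_blin_comp (flip (bcomps W V W)) oA GA.
have l3 := Cn_bilin (bcomps _ _ _) oA (Cn_bilin (bcomps _ _ _) oA l1 l2) dFA.
apply: (Cn_ext oA _ (Cn_blin_comp (- bid _) oA l3)) => // x Ax.
exact: esym (dG x Ax).2.
Qed.

End CnCalculus.

(** * Row vectors and the mean value inequality *)

(* Declares the join of the normed and the complete structures of matrices. *)
HB.instance Definition _ (R : realType) (m n : nat) :=
  Uniform_isComplete.Build 'M[R]_(m, n) (@cauchy_cvg 'M[R]_(m, n)).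

Section RowVectors.
Variable R : realType.

Lemma rV_coord_le m (v : 'rV[R]_m) j : `|v 0 j| <= `|v|.
Proof.
rewrite [leRHS]/Num.norm/= mx_normrE.
by apply/bigmax_geP; right; exists (0, j).
Qed.

Lemma rV_norm_le m (v : 'rV[R]_m) (c : R) : 0 <= c ->
  (forall j, `|v 0 j| <= c) -> `|v| <= c.
Proof.
move=> c0 vc; rewrite [leLHS]/Num.norm/= mx_normrE.
by apply: bigmax_le => // -[i j] _; rewrite /= ord1.
Qed.

Lemma rV_linear_bounded m (W : normedModType R) (T : {linear 'rV[R]_m -> W}) v :
  `|T v| <= (\sum_j `|T (delta_mx 0 j)|) * `|v|.
Proof.
rewrite {1}(row_sum_delta v) linear_sum mulr_suml.
apply: le_trans (ler_norm_sum _ _ _) _; apply: ler_sum => j _.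
by rewrite linearZ normrZ mulrC ler_wpM2l// rV_coord_le.
Qed.

Definition rV_blin m (W : normedModType R) (T : {linear 'rV[R]_m -> W}) :
  blin 'rV[R]_m W := mkblin (linearP T) (rV_linear_bounded T).

(** An injective square matrix is invertible, and linear maps on row vectors are automatically
    bounded. *)
Lemma rV_blin_iso m (T : blin 'rV[R]_m 'rV[R]_m) : injective T -> blin_iso T.
Proof.
move=> Ti; pose A := lin1_mx T.
have TA v : T v = v *m A by rewrite mul_rV_lin1.
have Au : A \in unitmx.
  rewrite -row_free_unit; apply: inj_row_free => v; rewrite -TA => Tv.
  by apply: Ti; rewrite Tv linear0.
exists (rV_blin (mulmxr (invmx A))); split=> v /=.
  by rewrite TA mulmxK.
by rewrite TA mulmxKV.
Qed.

Fact bcoord_linear m (j : 'I_m) : linear (fun v : 'rV[R]_m => v 0 j).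
Proof. by move=> a u v; rewrite !mxE. Qed.
Fact bcoord_bound m (j : 'I_m) (v : 'rV[R]_m) : `|v 0 j| <= 1 * `|v|.
Proof. by rewrite mul1r rV_coord_le. Qed.
Definition bcoord m (j : 'I_m) : blin 'rV[R]_m R :=
  mkblin (bcoord_linear j) (bcoord_bound j).

Fact bline_linear (W : normedModType R) (w : W) : linear (fun t : R => t *: w).
Proof. by move=> a s t; rewrite scalerDl scalerA. Qed.
Fact bline_bound (W : normedModType R) (w : W) (t : R) :
  `|t *: w| <= `|w| * `|t|.
Proof. by rewrite normrZ mulrC. Qed.
Definition bline (W : normedModType R) (w : W) : blin R W :=
  mkblin (bline_linear w) (bline_bound w).

Lemma Cn_row n (V : normedModType R) m (A : set V) (f : 'I_m -> V -> R) :
  open A -> (forall i, Cn n A (f i)) ->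
  Cn n A (fun x => \row_i f i x : 'rV[R]_m).
Proof.
move=> oA fA.
have := Cn_sum oA
  (fun i => Cn_blin_comp (bline (delta_mx 0 i : 'rV[R]_m)) oA (fA i)).
apply: (Cn_ext oA) => x _ /=.
by rewrite [RHS]row_sum_delta; apply: eq_bigr => i _; rewrite mxE.
Qed.

(** The one-variable mean value theorem is applied to each coordinate along a segment. The norm of
    row vectors is the maximum norm, so no constant is lost. *)
Lemma lipschitz_ball (V : normedModType R) m (f : V -> 'rV[R]_m) (z : V)
    (r c : R) :
  (forall x, ball z r x -> differentiable f x /\ `|dop f x| <= c) ->
  forall x y, ball z r x -> ball z r y -> `|f x - f y| <= c * `|x - y|.
Proof.
move=> fc x y zx zy.
have c0 : 0 <= c by rewrite (le_trans _ (fc x zx).2).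
pose p : R -> V := cst y \+ bline (x - y).
have zp t : 0 <= t <= 1 -> ball z r (p t).
  move=> /andP[t0 t1]; move: zx zy; rewrite -!ball_normE /= => zx zy.
  have -> : z - (y + t *: (x - y)) = t *: (z - x) + (1 - t) *: (z - y).
    have -> : z - x = (z - y) - (x - y) by rewrite opprB addrA subrK.
    rewrite opprD addrA; move: (z - y) (x - y) => w u.
    by rewrite scalerBr scalerBl scale1r [RHS]addrC addrA subrK.
  apply: le_lt_trans (ler_normD _ _) _; rewrite !normrZ !ger0_norm ?subr_ge0//.
  (* For [t > 0] the strict inequality comes from the summand with factor [t], which degenerates at
     [t = 0]. *)
  have [->|t0'] := eqVneq t 0; first by rewrite mul0r add0r subr0 mul1r.
  have {}t0 : 0 < t by rewrite lt_neqAle eq_sym t0'.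
  move: zx zy; rewrite -subr_gt0 => /(mulr_gt0 t0) zx.
  rewrite -subr_ge0 in t1; rewrite -subr_gt0 => /ltW /(mulr_ge0 t1) zy; lra.
have dp t : differentiable p t /\ dop p t = bline (x - y).
  have d1 := differentiable_cst y t.
  have d2 := blin_differentiable (bline (x - y)) t.
  split; first exact: (differentiableD d1 d2).
  apply: etrans (dopD d1 d2) _.
  by rewrite (dop_cst y t) (dop_blin (bline (x - y)) t) add0r.
apply: rV_norm_le => [|j]; first by rewrite mulr_ge0.
pose phi := bcoord j \o (f \o p).
have dphi (t : R) : 0 <= t <= 1 ->
    is_derive t 1 phi ((dop f (p t) (x - y)) 0 j).
  move=> /zp/fc[df _].
  have dfp := differentiable_comp (dp t).1 df.
  have dc := blin_differentiable (bcoord j) (f (p t)).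
  have dphi := differentiable_comp dfp dc.
  apply: DeriveDef; first exact: diff_derivable.
  rewrite deriveE//; apply: etrans (esym (dopE dphi 1)) _.
  rewrite (dop_comp dfp dc) (dop_comp (dp t).1 df) (dop_blin (bcoord j)).
  by rewrite (dp t).2 /= scale1r.
have dphi' (t : R) : t \in `]0, 1[%R ->
    is_derive t 1 phi ((dop f (p t) (x - y)) 0 j).
  by rewrite in_itv/= => /andP[/ltW t0 /ltW t1]; apply: dphi; rewrite t0.
have cphi : {within `[0, 1], continuous phi}.
  apply: derivable_within_continuous => t; rewrite in_itv/= => t01.
  by have [] := dphi t t01.
have [t t01 E] := MVT_segment ler01 dphi' cphi.
have -> : (f x - f y) 0 j = phi 1 - phi 0.
  by rewrite /phi/p/= scale1r scale0r addr0 (addrC y) subrK !mxE.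
rewrite E subr0 mulr1 (le_trans (rV_coord_le _ _))//.
rewrite (le_trans (blin_ge _ _))// ler_wpM2r//.
exact: (fc _ (zp t t01)).2.
Qed.

End RowVectors.

(** * The inverse function theorem *)

Section InverseFunction.
Variable R : realType.

Lemma blin_invP (V W : normedModType R) (T : blin V W) : blin_iso T ->
  cancel T (blin_inv T) /\ cancel (blin_inv T) T.
Proof.
by move=> iT; have := xgetPex 0 iT.
Qed.

(** Solving [z + g z = y] means finding a fixed point of [y - g z], a contraction with constant one
    half. *)
Lemma open_lipschitz_perturbation (E : completeNormedModType R) (U : set E)
    (g : E -> E) : open U ->
  (forall x y, U x -> U y -> `|g x - g y| <= 2^-1 * `|x - y|) ->
  open ((fun x => x + g x) @` U).
Proof.
move=> oU gU; rewrite openE => _ [x Ux <-] /=.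
have /nbhs_closedballP[s sU] := open_nbhs_nbhs (conj oU Ux).
rewrite closed_ballE// in sU.
have s0 : 0 < s%:num / 2 by rewrite divr_gt0.
(* Half of the radius [s] allows for the distance from [y] to [x + g x], the other half for the
   variation of [g]; so [phi] preserves the closed ball. *)
apply/nbhs_ballP; exists (s%:num / 2) => //= y; rewrite -ball_normE /= => xy.
pose C := closed_ball_ Num.Def.normr x s%:num.
pose phi z := y - g z.
have xC : C x by rewrite /C/closed_ball_/= subrr normr0.
have phiC : {homo phi : z / C z >-> C z}.
  move=> z Cz; rewrite /C/closed_ball_/= /phi.
  have -> : x - (y - g z) = (x + g x - y) - (g x - g z).
    move: (g x) (g z) => a b.
    rewrite !opprB (addrC b (- a)) [RHS]addrA (addrAC x a) addrK.
    by rewrite addrA addrAC.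
  rewrite (le_trans (ler_normB _ _))// [leRHS](splitr s%:num) lerD//.
    exact: ltW.
  rewrite (le_trans (gU _ _ (sU _ xC) (sU _ Cz)))// mulrC ler_wpM2r//.
have [|||z Cz Ez] := @banach_fixed_point R E C (mkfun phiC).
- exists 2^-1%:nng; split; first by rewrite /= invf_lt1// ltr1n.
  move=> [u v] [/= Cu Cv]; rewrite /phi.
  have -> : y - g u - (y - g v) = - (g u - g v).
    by rewrite !opprB addrC addrA subrK.
  by rewrite normrN gU//; exact: sU.
- exact: closed_closed_ball_.
- by exists x.
- exists z; first exact: sU.
  by rewrite {1}Ez /= /phi subrK.
Qed.

Lemma lipschitz_near_continuous (V W : normedModType R) (f : V -> W) y (K : R) :
  (\forall w \near y, `|f w - f y| <= K * `|w - y|) -> {for y, continuous f}.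
Proof.
move=> fK; apply/cvgrPdist_le => d d0.
have K0 : 0 < `|K| + 1 by rewrite ltr_wpDl.
have := continuous_near (@blin_continuous _ _ _ (bid V) y) (divr_gt0 d0 K0).
apply: filterS2 fK => w wK wd; rewrite distrC (le_trans wK)//.
apply: (@le_trans _ _ ((`|K| + 1) * (d / (`|K| + 1)))).
  apply: le_trans (_ : (`|K| + 1) * `|w - y| <= _); last first.
    by rewrite ler_wpM2l// ltW.
  by rewrite ler_wpM2r// (le_trans (ler_norm _))// lerDl.
by rewrite mulrC divfK// gt_eqF.
Qed.

(** [T'] carries the first-order error of [f] at [th y] to that of [th] at [y], up to sign; the
    Lipschitz bound on [th] makes it small relative to [w - y]. *)
Lemma frechet_local_inverse (V W : normedModType R) (f : V -> W) (th : W -> V)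
    (y : W) (T' : blin W V) (K : R) :
  differentiable f (th y) -> cancel (dop f (th y)) T' ->
  {for y, continuous th} ->
  (\forall w \near y, f (th w) = w) ->
  (\forall w \near y, `|th w - th y| <= K * `|w - y|) ->
  frechet th y T'.
Proof.
move=> df T'K thc fth thK; apply: (@frechetM _ _ _ _ _ _ (`|T'| * K)) => e e0.
have fthy := nbhs_singleton fth.
have := thc _ (dop_frechet df e0).
apply: filterS3 fth thK => w fw wK /=.
rewrite fw fthy => H.
have -> : th w - th y - T' (w - y) =
    - T' (w - y - dop f (th y) (th w - th y)).
  by rewrite [T' (w - y - _)]linearB/= T'K opprB.
rewrite normrN (le_trans (blin_ge _ _))// -mulrA ler_wpM2l//.
by rewrite (le_trans H)// mulrCA ler_wpM2l// ltW.
Qed.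

(** A vector [v] killed by [S] equals [- T' ((S - T) v)], whose norm is at most half that of [v]. *)
Lemma near_identity_injective (V W : normedModType R) (T : blin V W)
   (T' : blin W V) (S : blin V W) : cancel T T' ->
  `|T'| * `|S - T| <= 2^-1 -> injective S.
Proof.
move=> TK ST; apply: raddf_inj => v Sv; apply/eqP; rewrite -normr_eq0.
have : `|v| <= 2^-1 * `|v|.
  have {1}-> : v = - T' ((S - T) v).
    rewrite -[(S - T) v]/(S v - T v) Sv sub0r linearN opprK.
    exact: esym (TK v).
  rewrite normrN (le_trans (blin_ge _ _))//.
  apply: le_trans (_ : `|T'| * (`|S - T| * `|v|) <= _).
    by rewrite ler_wpM2l// blin_ge.
  by rewrite mulrA ler_wpM2r.
have := normr_ge0 v; lra.
Qed.

Variable m : nat.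
Let E := 'rV[R]_m.

Theorem inverse_function (f : E -> E) (A : set E) (x0 : E) : open A -> A x0 ->
  smooth_on A f -> injective (dop f x0) ->
  exists2 B : set E, [/\ open B, B x0 & B `<=` A] &
  exists th : E -> E, [/\ open (f @` B), forall x, B x -> th (f x) = x
    & smooth_on (f @` B) th].
Proof.
move=> oA Ax0 fA /rV_blin_iso[T' [TK T'K]].
set T := dop f x0 in TK T'K.
have df x : A x -> differentiable f x by have [df _] := fA 1%N; exact: df.
have dfc : {for x0, continuous (dop f)} by have [_ /(_ x0 Ax0)] := fA 1%N.
(* Chosen so that [|T'| * |S - T|] is at most one half whenever [|S - T| <= e]. *)
pose e : R := 2^-1 / (`|T'| + 1).
have e0 : 0 < e by rewrite divr_gt0// ltr_wpDl.
have [r r0 rA] : exists2 r : R, 0 < r & forall x, ball x0 r x ->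
    A x /\ `|dop f x - T| <= e.
  have /nbhs_ballP[r /= r0 rP] : \forall x \near x0, A x /\ `|dop f x - T| <= e.
    by apply: filterI; [exact: open_nbhs_nbhs|exact: (continuous_near dfc e0)].
  by exists r.
have T'e S : `|S - T| <= e -> `|T'| * `|S - T| <= 2^-1.
  move=> Se; apply: (@le_trans _ _ ((`|T'| + 1) * e)).
    by rewrite ler_pM// lerDl.
  by rewrite mulrC divfK// gt_eqF// ltr_wpDl.
pose B := ball x0 r.
(* [T' \o f] is the identity plus [g], whose derivative [T' (f' - T)] has norm at most one half on
   the ball. *)
pose g x := T' (f x) - x.
have gB x y : B x -> B y -> `|g x - g y| <= 2^-1 * `|x - y|.
  apply: lipschitz_ball => z /rA[Az zT].
  have d1 := differentiable_comp (df z Az) (blin_differentiable T' (f z)).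
  have d2 := blin_differentiable (- bid E) z.
  split; first exact: (differentiableD d1 d2).
  rewrite [X in `|X| <= _](_ : _ = bcomp T' (dop f z - T)).
    by rewrite (le_trans (bcomp_norm _ _))// T'e.
  apply: etrans (dopD d1 d2) _.
  rewrite (dop_blin (- bid E) z).
  rewrite (dop_comp (df z Az) (blin_differentiable T' _)).
  rewrite (dop_blin T' _); move: (dop f z) => S; apply: blin_ext => v.
  by rewrite -[LHS]/(T' (S v) - v) -[RHS]/(T' (S v - T v)) linearB/= TK.
have oB : open B by exact: ball_open.
have fg x : T' (f x) = x + g x by rewrite addrC subrK.
(* This estimate yields both the injectivity of [f] on [B] and the Lipschitz bound on its
   inverse. *)
have lip x y : B x -> B y -> `|x - y| <= 2 * `|T'| * `|f x - f y|.
  move=> Bx By; have := gB x y Bx By.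
  have : `|x - y| <= `|T'| * `|f x - f y| + `|g x - g y|.
    have -> : x - y = T' (f x - f y) - (g x - g y).
      by rewrite linearB/= !fg opprD addrACA addrK.
    by rewrite (le_trans (ler_normB _ _))// lerD// blin_ge.
  lra.
exists B.
  by split=> // [|x /rA[]//]; exact: ballxx.
(* A chosen preimage in [B]; off the image of [B] the value is the default [x0]. *)
pose th y := xget x0 (B `&` f @^-1` [set y]).
have thP y : (f @` B) y -> B (th y) /\ f (th y) = y.
  move=> [x Bx <-].
  have ex : exists x', (B `&` f @^-1` [set f x]) x' by exists x.
  by have := xgetPex x0 ex.
have thK x : B x -> th (f x) = x.
  move=> Bx; have [|By fy] := thP (f x); first by exists x.
  apply/eqP; rewrite -subr_eq0 -normr_eq0 eq_le normr_ge0 andbT.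
  by rewrite (le_trans (lip _ _ By Bx))// fy subrr normr0 mulr0.
have ofB : open (f @` B).
  (* As [T'] is injective, the image under [f] is the [T']-preimage of the image under the identity
     plus [g], which is open. *)
  have -> : f @` B = T' @^-1` ((fun x => x + g x) @` B).
    apply/seteqP; split=> [_ [x Bx <-]|y [x Bx]] /=.
      by exists x => //; rewrite fg.
    rewrite -fg => xy; exists x => //; exact: (can_inj T'K).
  apply: open_comp; last exact: open_lipschitz_perturbation.
  by move=> y _; exact: blin_continuous.
exists th; split=> //.
have thL y : (f @` B) y ->
    \forall w \near y, `|th w - th y| <= 2 * `|T'| * `|w - y|.
  move=> By; apply: filterS (open_nbhs_nbhs (conj ofB By)) => w Bw.
  by have [[? {2}<-] [? {2}<-]] := (thP w Bw, thP y By); exact: lip.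
have thc y : (f @` B) y -> {for y, continuous th}.
  by move=> By; exact: lipschitz_near_continuous (thL y By).
have dfI x : B x -> cancel (dop f x) (blin_inv (dop f x)) /\
    cancel (blin_inv (dop f x)) (dop f x).
  move=> /rA[_ xT]; apply/blin_invP/rV_blin_iso.
  exact: near_identity_injective TK (T'e _ xT).
pose H y := blin_inv (dop f (th y)).
have dth y : (f @` B) y -> differentiable th y /\ dop th y = H y.
  move=> By; have [Bty fty] := thP y By; apply: frechet_dop.
  apply: (frechet_local_inverse (df _ (rA _ Bty).1) (dfI _ Bty).1 (thc y By)
    _ (thL y By)).
  apply: filterS (open_nbhs_nbhs (conj ofB By)) => w Bw.
  by have [] := thP w Bw.
(* Bootstrapping again: the derivative of [th] is the inverse of [dop f \o th], which is as regular
   as [th] is already known to be. *)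
elim=> [|n IH]; first exact: thc.
split=> [y By|]; first exact: (dth y By).1.
apply: (Cn_ext ofB (fun y By => esym (dth y By).2)).
apply: (Cn_inverse ofB (fun y By => dfI _ (thP y By).1)).
apply: (Cn_comp ofB oA _ IH (fA n.+1).2) => y By.
by have [/rA[]] := thP y By.
Qed.

End InverseFunction.

(** * The core package *)

Lemma open_setX (T U : topologicalType) (A : set T) (B : set U) :
  open A -> open B -> open (A `*` B).
Proof.
move=> oA oB.
have -> : A `*` B = fst @^-1` A `&` snd @^-1` B by [].
by apply: openI; apply: open_comp => // x _; [exact: cvg_fst|exact: cvg_snd].
Qed.

(** * Partial derivatives through affine slices of a product *)

Section PartialDerivatives.
Variables (R : realType) (U V W : normedModType R) (F : U * V -> W) (w : U * V).
Hypothesis dF : differentiable F w.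

Lemma dop_partial1 : differentiable (fun u => F (u, w.2)) w.1 /\
  dop (fun u => F (u, w.2)) w.1 = bcomp (dop F w) (binl U V).
Proof.
pose c := cst (0 : U, w.2) \+ binl U V.
have d1 := differentiable_cst (0 : U, w.2) w.1.
have d2 := blin_differentiable (binl U V) w.1.
have dc : differentiable c w.1 := differentiableD d1 d2.
have dcE : dop c w.1 = binl _ _.
  apply: etrans (dopD d1 d2) _.
  by rewrite (dop_cst (0 : U, w.2)) (dop_blin (binl _ _)) add0r.
have cw u : c u = (u, w.2) by rewrite /c -[LHS]/(0 + u, w.2 + 0) addr0 add0r.
have ccw : c w.1 = w by rewrite cw; case: (w).
have Fc : F \o c = (fun u => F (u, w.2)) by apply/funext => u /=; rewrite cw.
have dFc : differentiable F (c w.1) by rewrite ccw.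
have := dop_comp dc dFc; have := differentiable_comp dc dFc.
by rewrite dcE ccw Fc.
Qed.

Lemma dop_partial2 : differentiable (fun v => F (w.1, v)) w.2 /\
  dop (fun v => F (w.1, v)) w.2 = bcomp (dop F w) (binr U V).
Proof.
pose c := cst (w.1, 0 : V) \+ binr U V.
have d1 := differentiable_cst (w.1, 0 : V) w.2.
have d2 := blin_differentiable (binr U V) w.2.
have dc : differentiable c w.2 := differentiableD d1 d2.
have dcE : dop c w.2 = binr _ _.
  apply: etrans (dopD d1 d2) _.
  by rewrite (dop_cst (w.1, 0 : V)) (dop_blin (binr _ _)) add0r.
have cw v : c v = (w.1, v) by rewrite /c -[LHS]/(w.1 + 0, 0 + v) addr0 add0r.
have ccw : c w.2 = w by rewrite cw; case: (w).
have Fc : F \o c = (fun v => F (w.1, v)) by apply/funext => v /=; rewrite cw.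
have dFc : differentiable F (c w.2) by rewrite ccw.
have := dop_comp dc dFc; have := differentiable_comp dc dFc.
by rewrite dcE ccw Fc.
Qed.

End PartialDerivatives.

(** * Smooth maps from a manifold, read in charts *)

Section ManifoldMaps.
Variables (R : realType) (E : normedModType R) (X : manifold E).

Lemma mfd_chart_ctgt (x y : X) : cdom x y -> ctgt x (chart x y).
Proof. by move=> xy; exists y. Qed.

Lemma ctgt_cinv (x : X) u :
  ctgt x u -> cdom x (cinv x u) /\ chart x (cinv x u) = u.
Proof. by move=> [y xy <-]; rewrite mfd_chartK. Qed.

Lemma open_ctgt_preimage (x : X) (U : set X) : open U ->
  open (ctgt x `&` cinv x @^-1` U).
Proof.
move=> oU; apply: ((continuous_inP (cinv x) (mfd_tgt_open x)).1 _ _ oU).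
by move=> u; rewrite inE => /mfd_cinv_cont.
Qed.

Lemma near_cdom (x y : X) : cdom x y -> \forall z \near y, cdom x z.
Proof. by move=> xy; exact: open_nbhs_nbhs (conj (mfd_dom_open x) xy). Qed.

(** The target has only identity charts, so smoothness needs checking in the charts of [X] alone;
    continuity at [x] is read in the chart at [x]. *)
Lemma smooth_map_vchart (W : normedModType R) (U : set X) (f : X -> W) :
  open U -> (forall x, smooth_on (ctgt x `&` cinv x @^-1` U) (f \o cinv x)) ->
  smooth_map X (vchart W) U f.
Proof.
move=> oU fU; split=> [x Ux|x y].
  have xx := mfd_dom x.
  have c1 : {for x, continuous (chart x)} by exact: mfd_chart_cont.
  have c2 : {for chart x x, continuous (f \o cinv x)}.
    by apply: (fU x 0%N); split; [exact: mfd_chart_ctgt|rewrite /= mfd_chartK].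
  have := continuous_comp c1 c2.
  rewrite /prop_for /continuous_at /= mfd_chartK//; apply: cvg_trans.
  apply: near_eq_cvg; apply: filterS (near_cdom xx) => z xz /=.
  by rewrite mfd_chartK.
by move=> n; apply: Cn_sub (fU x n) => u [xu [Uu _]].
Qed.

Lemma smooth_map_local (W : normedModType R) (U : set X) (f : X -> W) x :
  smooth_map X (vchart W) U f ->
  smooth_on (ctgt x `&` cinv x @^-1` U) (f \o cinv x).
Proof.
by move=> [_ /(_ x (0 : W)) fU] n; apply: Cn_sub (fU n) => u [xu Uu].
Qed.

Lemma smooth_map_sub (F : normedModType R) (Y : charted F) (U V : set X)
   (f : X -> Y) : V `<=` U -> smooth_map X Y U f -> smooth_map X Y V f.
Proof.
move=> VU [cf sf]; split=> [x /VU|x y n]; first exact: cf.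
by apply: Cn_sub (sf x y n) => u [xu [/VU]].
Qed.

End ManifoldMaps.

(** * Smoothness of the core package and its first-order response *)

Section CorePackage.
Variables (R : realType) (n d : nat) (M : fmanifold R n) (N : fmanifold R d).
Variables (G : lie_group R) (aM : action G M) (aN : action G N).
Variables (h : tensor2 N) (gam : R -> M) (L : R) (k : nat) (alpha : R).
Variables (GG : metric_manifold aM gam L k alpha).
Variables (cond : set (M -> N)) (rep : M -> N).
Variables (HH : map_manifold aM aN k.+2 alpha cond rep).
Variables (YY : section_bundle aM aN k alpha (mapof (m:=HH))).
Hypothesis hF : F_smooth h GG YY.
Variables (m : nat) (S : fmanifold R m) (p0 : S) (gS : S -> GG).
Hypothesis hgS : smooth_map S GG setT gS.
Variables (f0 : HH) (S0 : set S) (Pi : S -> HH).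
Hypothesis hPi : harmonic_branch h YY gS p0 f0 S0 Pi.

Let g0 := gS p0.
Let Omega := ctgt g0 `*` (ctgt f0 `&` cinv f0 @^-1` tdom YY f0).
Let F := Floc h YY g0 f0.
Let K (w : mm_model GG * mp_model HH) : opJ YY := Jloc h YY g0 f0 w.1 w.2.

Lemma open_Omega : open Omega.
Proof.
apply: open_setX; first exact: mfd_tgt_open.
by apply: open_ctgt_preimage; exact: tdom_open.
Qed.

Lemma F_smooth_on : smooth_on Omega F.
Proof. exact: hF.2. Qed.

(** The vertical derivative is the full derivative precomposed with the inclusion of the second
    factor, a fixed bounded operation; so the smoothness of [F] passes to [K]. *)
Lemma KE w : Omega w ->
  flip (bcomps _ _ _) (binr (mm_model GG) (mp_model HH)) (dop F w) = K w.
Proof.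
by move=> Ow; exact: esym (dop_partial2 ((F_smooth_on 1).1 _ Ow)).2.
Qed.

Lemma K_smooth : smooth_on Omega K.
Proof.
move=> r; apply: (Cn_ext open_Omega KE).
exact: (Cn_blin_comp (flip (bcomps _ _ _) (binr (mm_model GG) (mp_model HH)))
  open_Omega (F_smooth_on r.+1).2).
Qed.

Let a (p1 : S) := chart g0 \o gS \o cinv p1.
Let b (p1 : S) := chart f0 \o Pi \o cinv p1.
Let O (p1 : S) := ctgt p1 `&` cinv p1 @^-1` S0.

Lemma open_O p1 : open (O p1).
Proof. exact: open_ctgt_preimage (hb_open hPi). Qed.

Lemma a_smooth p1 : smooth_on (O p1) (a p1).
Proof.
by move=> r; apply: Cn_sub (hgS.2 p1 g0 r) => u [p1u /(hb_dom hPi)[]].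
Qed.

Lemma b_smooth p1 : smooth_on (O p1) (b p1).
Proof.
move=> r; apply: Cn_sub ((hb_smooth hPi).2 p1 f0 r) => u [p1u S0u].
by have [] := hb_dom hPi S0u.
Qed.

Lemma ab_Omega p1 u : O p1 u -> Omega (a p1 u, b p1 u).
Proof.
move=> [p1u S0u]; have [h1 h2 h3] := hb_dom hPi S0u; split=> /=.
  exact: mfd_chart_ctgt.
by split; [exact: mfd_chart_ctgt|rewrite /= mfd_chartK].
Qed.

(** In a chart the Jacobi operator is [K] after the pair of local expressions of the metric and the
    harmonic map; its inverse is smooth by [Cn_inverse]. *)
Lemma core_local_smooth p1 :
  smooth_on (O p1) (core_package h YY gS p0 f0 Pi \o cinv p1).
Proof.
move=> r; have J_smooth := Cn_comp (@open_O p1) open_Omega (@ab_Omega p1)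
  (Cn_pair (@open_O p1) (@a_smooth p1 r) (@b_smooth p1 r)) (K_smooth r).
apply: (Cn_pair (@open_O p1) J_smooth).
apply: (Cn_inverse (@open_O p1) _ J_smooth) => u [_ S0u].
exact: (blin_invP (hb_iso hPi S0u)).
Qed.

Lemma core_smooth :
  smooth_map S (vchart (Xcore YY)) S0 (core_package h YY gS p0 f0 Pi).
Proof.
by apply: smooth_map_vchart (hb_open hPi) _ => p1; exact: core_local_smooth.
Qed.

Let A := core_package h YY gS p0 f0 Pi.
Let D := universal_response h YY gS p0 f0 Pi.
Let J := jacobi_response h YY gS p0 f0 Pi.

Lemma response_diff : differentiable (A \o cinv p0) (chart p0 p0) /\
  forall v, D v = dop (A \o cinv p0) (chart p0 p0) v.
Proof.
have Ox0 : O p0 (chart p0 p0).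
  have p00 := mfd_dom p0; split; first exact: mfd_chart_ctgt.
  by rewrite /= mfd_chartK//; exact: hb_in hPi.
have dA := (@core_local_smooth p0 1).1 _ Ox0.
by split=> // v; exact: esym (dopE dA v).
Qed.

(** By the chain rule the derivative of [K] acts on the pair of variations of metric and map.
    Splitting this pair along [binl] and [binr] gives the two partial derivatives in the effective
    response. *)
Lemma response_fst v : (D v).1 = J v.
Proof.
set x0 := chart p0 p0.
have p00 := mfd_dom p0.
have Ox0 : O p0 x0.
  split; first exact: mfd_chart_ctgt.
  by rewrite /= mfd_chartK//; exact: hb_in hPi.
have [dA DE] := response_diff.
have db1 := blin_differentiable (bfst (opJ YY) (opG YY)).
have E1 := dop_comp dA (db1 _).
have da := (@a_smooth p0 1).1 _ Ox0; have db := (@b_smooth p0 1).1 _ Ox0.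
have dK := (K_smooth 1).1 _ (ab_Omega Ox0).
have dab := differentiable_pair da db.
have E2 := dop_comp dab dK.
have -> : (D v).1 = dop K (a p0 x0, b p0 x0) (dop (a p0) x0 v, dop (b p0) x0 v).
  rewrite DE.
  have -> : (dop (A \o cinv p0) x0 v).1 =
      dop (bfst (opJ YY) (opG YY) \o (A \o cinv p0)) x0 v.
    by rewrite E1 (dop_blin (bfst _ _)).
  apply: etrans (congr1 (fun T : blin _ _ => T v) E2) _.
  congr (dop K _ _); apply: etrans (dopE dab v) _.
  rewrite (diff_pair da db); congr pair; exact: esym (dopE _ v).
have -> : (dop (a p0) x0 v, dop (b p0) x0 v) =
    binl _ _ (dop (a p0) x0 v) + binr _ _ (dop (b p0) x0 v).
  by rewrite -[RHS]/(dop (a p0) x0 v + 0, 0 + dop (b p0) x0 v) addr0 add0r.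
have aE : a p0 x0 = chart g0 g0 by rewrite /a/= mfd_chartK.
have bE : b p0 x0 = chart f0 f0.
  by rewrite /b/= mfd_chartK// (hb_base hPi).
have T1 : dop (a p0) x0 v = tmap gS p0 v by exact: dopE.
have T2 : dop (b p0) x0 v = tmap Pi p0 v.
  by rewrite /tmap (hb_base hPi); exact: dopE.
rewrite T1 T2 linearD aE bE in dK *.
have [k1 e1] := dop_partial1 dK; have [k2 e2] := dop_partial2 dK.
have -> : J v = dop (fun u => K (u, chart f0 f0)) (chart g0 g0) (tmap gS p0 v)
    + dop (fun u => K (chart g0 g0, u)) (chart f0 f0) (tmap Pi p0 v).
  by congr (_ + _); exact: esym (dopE _ _).
by rewrite e1 e2.
Qed.

End CorePackage.

(** * Detection by scalars and embeddings *)

Section Detection.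
Variables (R : realType) (m : nat) (S : fmanifold R m) (p0 : S).
Variables (X : normedModType R) (A : S -> X) (S0 : set S).
Hypotheses (oS0 : open S0) (S0p0 : S0 p0).
Hypothesis sA : smooth_map S (vchart X) S0 A.

Section Scalars.
Variables (psi : 'I_m -> X -> R) (U : set X).
Hypotheses (oU : open U) (Ua0 : U (A p0)).
Hypothesis sU : forall i, smooth_on U (psi i).

Let Psi (p : S) : 'rV[R]_m := \row_i psi i (A p).
Let x0 := chart p0 p0.
Let V0 (p : S) := ctgt p `&` cinv p @^-1` S0.
Let V (p : S) := V0 p `&` (A \o cinv p) @^-1` U.

Lemma detect_open p : open (V p).
Proof.
have oV0 : open (V0 p) by exact: open_ctgt_preimage.
apply: ((continuous_inP (A \o cinv p) oV0).1 _ _ oU) => u.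
by rewrite inE => Vu; exact: (smooth_map_local p sA 0%N _ Vu).
Qed.

Lemma detect_smooth p : smooth_on (V p) (Psi \o cinv p).
Proof.
move=> r; apply: (Cn_row (@detect_open p)) => i.
apply: (Cn_comp (@detect_open p) oU _ _ (@sU i r)) => [u [_]//|].
by apply: (Cn_sub _ (smooth_map_local p sA r)) => u [].
Qed.

Lemma detect_base : V p0 x0.
Proof.
have p00 := mfd_dom p0; split; last by rewrite /= /x0 mfd_chartK.
by split; [exact: mfd_chart_ctgt|rewrite /= mfd_chartK].
Qed.

Hypothesis inj : forall v,
  (forall i, 'd (psi i) (A p0) (dop (A \o cinv p0) x0 v) = 0) -> v = 0.

(** The i-th coordinate of the differential is, by the chain rule, the differential of [psi i] on
    the image of [v], so [inj] applies. *)
Lemma detect_injective : injective (dop (Psi \o cinv p0) x0).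
Proof.
apply: raddf_inj => v dv; apply: inj => i.
have Vx0 := detect_base.
have dA : differentiable (A \o cinv p0) x0.
  by apply: (smooth_map_local p0 sA 1%N).1; exact: Vx0.1.
have dPsi := (@detect_smooth p0 1).1 _ Vx0.
have Ax0 : (A \o cinv p0) x0 = A p0.
  by rewrite /= /x0 mfd_chartK//; exact: mfd_dom.
have dpsi : differentiable (psi i) ((A \o cinv p0) x0).
  by apply: (sU i 1%N).1; rewrite Ax0.
have E1 := dop_comp dA dpsi.
have E2 := dop_comp dPsi (blin_differentiable (bcoord R i) _).
have E : bcoord R i \o (Psi \o cinv p0) = psi i \o (A \o cinv p0).
  by apply/funext => u; rewrite /= mxE.
rewrite E E1 (dop_blin (bcoord R i)) in E2.
have := congr1 (fun T : blin _ _ => T v) E2.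
rewrite -[RHS]/(dop (Psi \o cinv p0) x0 v 0 i) dv mxE => <-.
by rewrite -Ax0; exact: esym (dopE dpsi _).
Qed.

(** The inverse function theorem is used in the chart at [p0], and its neighbourhood and inverse are
    carried back to [S]. *)
Lemma detection : injective (tmap (Psi : S -> vchart 'rV[R]_m) p0) /\
  exists2 S1 : set S, [/\ open S1, S1 p0 & S1 `<=` S0 `&` A @^-1` U]
    & diffeo_onto_open S1 Psi.
Proof.
have dPsi := (@detect_smooth p0 1).1 _ detect_base.
split.
  move=> v w vw; apply: detect_injective.
  by apply: etrans (dopE dPsi v) (etrans vw _); exact: esym (dopE dPsi w).
have [B [oB Bx0 BV] [th [ofB thK sth]]] :=
  inverse_function (@detect_open p0) detect_base (@detect_smooth p0)
    detect_injective.
pose S1 := cdom p0 `&` chart p0 @^-1` B.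
have oS1 : open S1.
  apply: ((continuous_inP (chart p0) (mfd_dom_open p0)).1 _ _ oB) => p.
  by rewrite inE => /mfd_chart_cont.
have PsiE p : cdom p0 p -> Psi p = (Psi \o cinv p0) (chart p0 p).
  by move=> p0p; rewrite /= mfd_chartK.
have S1S0 : S1 `<=` S0 `&` A @^-1` U.
  by move=> p [p0p Bp]; have [[_ +] +] := BV _ Bp; rewrite /= mfd_chartK.
have imE : Psi @` S1 = (Psi \o cinv p0) @` B.
  apply/seteqP; split=> [_ [p [p0p Bp] <-]|_ [u Bu <-]].
    by exists (chart p0 p) => //; rewrite -PsiE.
  have [[/ctgt_cinv[c1 c2] _] _] := BV u Bu.
  by exists (cinv p0 u) => //; split=> //; rewrite /= c2.
exists S1; first by split=> //; split; [exact: mfd_dom|].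
split.
- by rewrite imE.
- apply: smooth_map_vchart => // p r; apply: Cn_sub (@detect_smooth p r).
  by move=> u [pu /S1S0[]].
exists (cinv p0 \o th); last first.
  by move=> p [p0p Bp]; rewrite PsiE//= thK// mfd_chartK.
have thB y : ((Psi \o cinv p0) @` B) y -> ctgt p0 (th y).
  by move=> [u Bu <-]; rewrite thK//; have [[]] := BV u Bu.
rewrite imE; split=> [y By|x p r].
  apply: continuous_comp; first exact: (sth 0%N).
  by apply: mfd_cinv_cont; exact: thB.
(* Seen in the chart at [p], the inverse is [th] followed by the transition map from [p0] to [p],
   which is smooth on [Q]. *)
pose Q := ctgt p0 `&` cinv p0 @^-1` cdom p.
have oQ : open Q by apply: open_ctgt_preimage; exact: mfd_dom_open.
have oW : open ((Psi \o cinv p0) @` B `&` th @^-1` Q).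
  apply: ((continuous_inP th ofB).1 _ _ oQ) => y.
  by rewrite inE => By; exact: (sth 0%N).
have WQ y : ((Psi \o cinv p0) @` B `&` th @^-1` Q) y -> Q (th y) by case.
have H := Cn_comp oW oQ WQ
  (Cn_sub (@subIsetl _ _ _) (sth r)) (mfd_smooth p0 p r).
apply: Cn_sub H => y [_ [By py]]; split=> //; split=> //; exact: thB.
Qed.

End Scalars.

(** The inverse [th] of [psi \o A] makes [th \o psi] a left inverse of [A] on [S1]. It gives
    injectivity, and its continuity recovers the topology of [S1]; the chain rule gives injective
    differentials. *)
Lemma embedding_of_factor (psi : X -> 'rV[R]_m) (U : set X) (S1 : set S) :
  open U -> smooth_on U psi -> open S1 -> S1 `<=` S0 `&` A @^-1` U ->
  diffeo_onto_open S1 (psi \o A) -> smooth_embedding A S1.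
Proof.
move=> oU sU oS1 S1S [oI sPsi [th sth thK]]; split.
- by apply: smooth_map_sub sA => p /S1S[].
- move=> p S1p; apply: raddf_inj => v dv.
  have pp := mfd_dom p; pose x := chart p p.
  have px : cinv p x = p by rewrite mfd_chartK.
  have Vx : (ctgt p `&` cinv p @^-1` S0) x.
    by split; [exact: mfd_chart_ctgt|rewrite /= px; have [] := S1S p S1p].
  have dA := (smooth_map_local p sA 1%N).1 _ Vx.
  have Ax : (A \o cinv p) x = A p by rewrite /= px.
  have dpsi : differentiable psi ((A \o cinv p) x).
    by apply: (sU 1%N).1; rewrite Ax; have [] := S1S p S1p.
  have dPsi := differentiable_comp dA dpsi.
  have dth : differentiable (chart p \o th) ((psi \o (A \o cinv p)) x).
    have := (sth.2 (0 : 'rV[R]_m) p 1%N).1; apply; split.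
      by exists (psi ((A \o cinv p) x)).
    rewrite /= px; split; first by exists p.
    by rewrite /= thK.
  have E1 := dop_comp dA dpsi.
  have E2 := dop_comp dPsi dth.
  have near_id : \forall u \near x,
      bid _ u = ((chart p \o th) \o (psi \o (A \o cinv p))) u.
    have oV := open_ctgt_preimage p oS1.
    have V1x : (ctgt p `&` cinv p @^-1` S1) x.
      by split; [exact: Vx.1|rewrite /= px].
    apply: filterS (open_nbhs_nbhs (conj oV V1x)) => u [pu S1u] /=.
    by rewrite thK//; have [_ ->] := ctgt_cinv pu.
  have [_ E3] := near_dop near_id (blin_differentiable (bid _) x).
  have := congr1 (fun T : blin _ _ => T v) (etrans (esym E3) E2).
  rewrite (dop_blin (bid _) x) E1 /= => ->.
  have -> : dop (A \o cinv p) x v = 0 by apply: etrans (dopE dA v) dv.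
  by rewrite !linear0.
- move=> p p'; rewrite !inE => S1p S1p' App'.
  by rewrite -(thK p S1p) -(thK p' S1p') /= App'.
- move=> p P S1p pP; exists (psi @^-1` (th @^-1` P)); last first.
    by move=> p' S1p' /=; rewrite thK.
  have c1 : {for A p, continuous psi}.
    by apply: (sU 0%N); have [] := S1S p S1p.
  have c2 : {for psi (A p), continuous th} by apply: sth.1; exists p.
  apply: c1; apply: c2; rewrite thK//.
Qed.

End Detection.

(** * Functionals on spaces of sections *)

Section HolderLinear.
Variables (R : realType) (alpha : R).

Lemma holder_le_bound n (V W : normedModType R) (A : set V) (f : V -> W) c :
  holder_le n alpha A f c -> forall x, A x -> `|f x| <= c.
Proof. by case: n => [|n] []. Qed.

Lemma holder_le_sub n (V W : normedModType R) (A B : set V) (f : V -> W) c :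
  B `<=` A -> holder_le n alpha A f c -> holder_le n alpha B f c.
Proof.
move=> BA; elim: n W f => [|n IH] W f [fc fa]; split; try by move=> x /BA /fc.
  by move=> x y /BA Ax /BA Ay; exact: fa.
exact: IH.
Qed.

Lemma holder_le_ext n (V W : normedModType R) (A : set V) (f g : V -> W) c :
  open A -> Cn n A f -> (forall x, A x -> f x = g x) ->
  holder_le n alpha A f c -> holder_le n alpha A g c.
Proof.
move=> oA; elim: n W f g => [|n IH] W f g fA fg [fc fa].
  by split=> [x Ax|x y Ax Ay]; rewrite -!fg//; [exact: fc|exact: fa].
have [df dfA] := fA; split=> [x Ax|]; first by rewrite -fg//; exact: fc.
apply: (IH _ _ _ dfA _ fa) => x Ax; apply: esym (near_dop _ (df x Ax)).2.
exact: filterS (open_nbhs_nbhs (conj oA Ax)).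
Qed.

Lemma holder_le_lin n (V W : normedModType R) (A : set V) (f g : V -> W)
    b c c' :
  open A -> Cn n A f -> Cn n A g ->
  holder_le n alpha A f c -> holder_le n alpha A g c' ->
  holder_le n alpha A (fun x => b *: f x + g x) (`|b| * c + c').
Proof.
move=> oA; elim: n W f g => [|n IH] W f g fA gA [fc fa] [gc ga].
  split=> [x Ax|x y Ax Ay].
    rewrite (le_trans (ler_normD _ _))// lerD//; last exact: gc.
    by rewrite normrZ ler_wpM2l// fc.
  rewrite opprD addrACA -scalerBr mulrDl (le_trans (ler_normD _ _))// lerD//.
    by rewrite normrZ -mulrA ler_wpM2l// fa.
  exact: ga.
have [[df dfA] [dg dgA]] := (fA, gA); split=> [x Ax|].
  rewrite (le_trans (ler_normD _ _))// lerD//; last exact: gc.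
  by rewrite normrZ ler_wpM2l// fc.
have dE x : A x -> b *: dop f x + dop g x = dop (fun x => b *: f x + g x) x.
  move=> Ax; have db := blin_differentiable (b *: bid W) (f x).
  apply: esym (etrans (dopD (differentiable_comp (df x Ax) db) (dg x Ax)) _).
  rewrite (dop_comp (df x Ax) db) (dop_blin (b *: bid W)).
  by congr (_ + _); move: (dop f x) => T; apply: blin_ext => v.
apply: (holder_le_ext oA _ dE (IH _ _ _ dfA dgA fa ga)).
exact: CnD oA (Cn_blin_comp (b *: bid _) oA dfA) dgA.
Qed.

Lemma Cka_lin k (V W : normedModType R) (A : set V) (f g : V -> W) b :
  open A -> Cka k alpha A f -> Cka k alpha A g ->
  Cka k alpha A (fun x => b *: f x + g x).
Proof.
move=> oA [fA fh] [gA gh]; split.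
  exact: CnD oA (Cn_blin_comp (b *: bid _) oA fA) gA.
move=> x Ax; have [B1 xB1 [c1 h1]] := fh x Ax; have [B2 xB2 [c2 h2]] := gh x Ax.
(* The interior is taken because derivatives of a linear combination are computed on an open set. *)
pose B := (B1 `&` B2 `&` A)°.
have oB : open B by exact: open_interior.
have BS : B `<=` B1 `&` B2 `&` A by exact: interior_subset.
exists B.
  apply: open_nbhs_nbhs; split=> //; rewrite /B/interior/=.
  by apply: filterI (open_nbhs_nbhs (conj oA Ax)); exact: filterI.
exists (`|b| * c1 + c2); apply: holder_le_lin => //.
- by apply: (Cn_sub _ fA) => y /BS[].
- by apply: (Cn_sub _ gA) => y /BS[].
- by apply: (holder_le_sub _ h1) => y /BS[[]].
- by apply: (holder_le_sub _ h2) => y /BS[[]].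
Qed.

End HolderLinear.

(** * Evaluation of sections at a point *)

Section SectionSpaces.
Variables (R : realType) (n d : nat) (M : fmanifold R n) (N : fmanifold R d).
Variables (G : lie_group R) (aM : action G M) (aN : action G N).
Variables (k : nat) (alpha : R) (f : M -> N).
Hypothesis fc : forall x, {for x, continuous f}.

Let sec := sections aM aN k alpha f.

Lemma sections_lin b s t : sec s -> sec t -> sec (fun x => b *: s x + t x).
Proof.
move=> [sC sE] [tC tE]; split=> [x0 y0|a x]; last by rewrite sE tE linearP.
have -> : sec_coord f (fun x => b *: s x + t x) x0 y0 =
    fun u => b *: sec_coord f s x0 y0 u + sec_coord f t x0 y0 u.
  by apply/funext => u; rewrite /sec_coord linearP.
apply: Cka_lin; [|exact: sC|exact: tC].
apply: open_ctgt_preimage; apply: open_comp; last exact: mfd_dom_open.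
by move=> x _; exact: fc.
Qed.

(** The transition map of a chart with itself is the identity near the point. *)
Lemma tcoord_id (y : N) v : tcoord y y v = v.
Proof.
have yy := mfd_dom y; have ty := mfd_chart_ctgt yy.
have near_id : \forall u \near chart y y, bid _ u = (chart y \o cinv y) u.
  apply: filterS (open_nbhs_nbhs (conj (mfd_tgt_open y) ty)) => u /ctgt_cinv[_].
  by move=> /= ->.
have [di de] := near_dop near_id (blin_differentiable (bid _) _).
rewrite /tcoord; apply: etrans (esym (dopE di v)) _.
by rewrite de (dop_blin (bid _)).
Qed.

Lemma sec_coord_pt s x : sec_coord f s x (f x) (chart x x) = s x.
Proof.
by rewrite /sec_coord mfd_chartK; [rewrite tcoord_id|exact: mfd_dom].
Qed.

Variables (Y : normedModType R) (theta : (M -> 'rV[R]_d) -> Y).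
Hypothesis thi : sections_iso aM aN k alpha f theta.

(* The functional is the evaluation of sections at a point. *)
Lemma section_functional (y : Y) : y != 0 -> exists Lam : blin Y R, Lam y != 0.
Proof.
move=> y0; have [thl thb _ thw] := thi.
(* [s] inverts [theta]; it is linear because a section is determined by its image. *)
have /choice[s sP] : forall z, exists s, sec s /\ theta s = z.
  by move=> z; have [s [sz _]] := thb z; exists s.
have sl b z z' : s (b *: z + z') = (fun x => b *: s z x + s z' x).
  have [t [_ tU]] := thb (b *: z + z').
  have [[s1 e1] [s2 e2]] := (sP z, sP z').
  rewrite -(tU _ (sP (b *: z + z'))); apply: tU; split.
    exact: sections_lin.
  by rewrite thl// e1 e2.
have [x [c xc]] : exists x c, s y x 0 c != 0.
  apply: contrapT => sy0; move/eqP: y0; apply.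
  have sy : s y = fun x => 0.
    apply/funext => x; apply/rowP => c; rewrite mxE.
    by apply: contrapT => /eqP xc; apply: sy0; exists x, c.
  (* Applying [theta] to [-1 *: s y + s y] shows that the zero section goes to 0, which would force
     [y = 0]. *)
  have [s1 e1] := sP y; have := thl (-1) _ _ s1 s1.
  rewrite e1 scaleN1r addNr => <-; rewrite -[LHS]e1; congr theta.
  by apply/funext => x; rewrite sy scaler0 addr0.
have xx := mfd_dom x.
(* On a one-point window the order-zero part of the Hoelder estimate bounds the value of the section
   at [x]. *)
have [C hC] := thw (Window x (f x) [set chart x x]) ltac:(
  split=> /=; [exact: compact_set1|move=> _ ->; exact: mfd_chart_ctgt|
  move=> _ ->; rewrite mfd_chartK//; exact: mfd_dom]).
pose ev z := s z x 0 c.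
have evl : linear (ev : Y -> R).
  by move=> b z z'; rewrite /ev sl !mxE.
have evb z : `|ev z| <= C * `|z|.
  have [sz ez] := sP z.
  have := holder_le_bound (hC _ sz) (x := chart x x) erefl.
  by rewrite /= sec_coord_pt ez; apply: le_trans; exact: rV_coord_le.
by exists (mkblin evl evb).
Qed.

End SectionSpaces.

(** * Choice of functionals *)

Section Pairing.
Variables (R : realType) (V : normedModType R) (m : nat).
Variables (J : blin 'rV[R]_m V) (e : m.-tuple 'rV[R]_m).
Hypothesis he : basis_of fullv e.

Lemma basis_sum v : v = \sum_j coord e j v *: tnth e j.
Proof.
rewrite {1}(coord_basis he (memvf v)).
by apply: eq_bigr => j _; rewrite (tnth_nth 0).
Qed.

(** The coordinates of [v] in the basis form a column killed by an invertible matrix. *)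
Lemma det_pairing (Lam : 'I_m -> blin V R) v :
  \det (\matrix_(i, j) Lam i (J (tnth e j))) != 0 ->
  (forall i, Lam i (J v) = 0) -> v = 0.
Proof.
set B := \matrix_(_, _) _ => detB Lv; pose c := \col_j coord e j v.
have Bu : B \in unitmx by rewrite unitmxE unitfE.
have Bc : B *m c = 0.
  apply/colP => i; rewrite !mxE -[RHS](Lv i) [in RHS](basis_sum v) !linear_sum.
  by apply: eq_bigr => j _; rewrite !mxE !linearZ mulrC.
have c0 : c = 0 by rewrite -(mulKmx Bu c) Bc mulmx0.
rewrite (basis_sum v) big1// => j _.
have := congr1 (fun A : 'cV_m => A j 0) c0.
by rewrite !mxE => ->; rewrite scale0r.
Qed.

(** Rows are added one at a time: a nonzero [w] with [J w] killed by all earlier functionals exists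
    while [k < m], and the next functional is taken nonzero on [J w]. *)
Lemma exists_det_pairing : injective J ->
  (forall w : V, w != 0 -> exists Lam : blin V R, Lam w != 0) ->
  exists Lam : 'I_m -> blin V R,
    \det (\matrix_(i, j) Lam i (J (tnth e j))) != 0.
Proof.
move=> Ji sep.
(* Indexing by all naturals lets a functional be appended without changing the type of the
   family. *)
have H k : (k <= m)%N -> exists Lam : nat -> blin V R,
    row_free (\matrix_(i < k, j < m) Lam i (J (tnth e j))).
  elim: k => [|k IH] km.
    by exists (fun=> 0); rewrite /row_free -leqn0 rank_leq_row.
  have [Lam] := IH (ltnW km); set B := \matrix_(_, _) _ => Bf.
  have : kermx B^T != 0.
    by rewrite kermx_eq0 /row_free mxrank_tr (eqP Bf) neq_ltn km.
  (* [u] holds the coordinates of [w]; being in the kernel of the transpose, it is orthogonal to the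
     first [k] rows. *)
  move=> /rowV0Pn[u /sub_kermxP uB u0].
  pose w := \sum_j u 0 j *: tnth e j.
  have Lw (L : blin V R) : L (J w) = \sum_j u 0 j * L (J (tnth e j)).
    by rewrite !linear_sum; apply: eq_bigr => j _; rewrite !linearZ.
  have w0 : w != 0.
    apply: contra u0 => /eqP w0; apply/eqP/rowP => j; rewrite mxE.
    have /freeP/(_ (fun j => u 0 j)) := basis_free he; apply.
    by rewrite -[RHS]w0; apply: eq_bigr => i _; rewrite (tnth_nth 0).
  have [|L Lw0] := sep (J w).
    by apply: contra w0 => /eqP Jw; apply/eqP/Ji; rewrite Jw linear0.
  exists (fun i => if (i < k)%N then Lam i else L).
  apply: inj_row_free => a; set B' := \matrix_(_, _) _ => aB.
  have aBj j : \sum_(i < k) a 0 (widen_ord (leqnSn k) i) * B i j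
      + a 0 ord_max * L (J (tnth e j)) = 0.
    have E : (a *m B') 0 j = 0 by rewrite aB mxE.
    rewrite -[RHS]E mxE big_ord_recr/=; congr (_ + _).
      by apply: eq_bigr => i _; rewrite !mxE /= ltn_ord.
    by rewrite mxE /= ltnn.
  (* Pairing the relation with [u] removes the first [k] rows and leaves [a 0 ord_max * L (J w)]. *)
  have am : a 0 ord_max = 0.
    apply/eqP; have : a 0 ord_max * L (J w) = 0.
      transitivity (\sum_j u 0 j *
        (\sum_(i < k) a 0 (widen_ord (leqnSn k) i) * B i j
          + a 0 ord_max * L (J (tnth e j)))); last first.
        by apply: big1 => j _; rewrite aBj mulr0.
      under eq_bigr do rewrite mulrDr mulr_sumr.
      rewrite big_split/= exchange_big/= big1 ?add0r; last first.
        move=> i _.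
        transitivity (a 0 (widen_ord (leqnSn k) i) * (u *m B^T) 0 i).
          by rewrite mxE mulr_sumr; apply: eq_bigr => j _; rewrite !mxE mulrCA.
        by rewrite uB mxE mulr0.
      by rewrite Lw mulr_sumr; apply: eq_bigr => j _; rewrite mulrCA.
    by move/eqP; rewrite mulf_eq0 (negbTE Lw0) orbF.
  pose a' : 'rV_k := \row_i a 0 (widen_ord (leqnSn k) i).
  have a'0 : a' = 0.
    apply: (row_free_inj Bf); rewrite mul0mx; apply/rowP => j.
    rewrite [RHS]mxE mxE.
    have := aBj j; rewrite am mul0r addr0 => aj0; rewrite -[RHS]aj0.
    by apply: eq_bigr => i _; rewrite mxE.
  apply/rowP => i; rewrite mxE; have [ik|ki] := ltnP i k.
    have := congr1 (fun A : 'rV_k => A 0 (Ordinal ik)) a'0.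
    by rewrite !mxE => <-; congr (a 0 _); apply: val_inj.
  rewrite -[RHS]am; congr (a 0 _); apply: val_inj => /=.
  by apply/eqP; rewrite eqn_leq ki -ltnS ltn_ord.
have [Lam] := H m (leqnn m); rewrite row_free_unit unitmxE unitfE => detB.
by exists (fun i => Lam i).
Qed.

End Pairing.

(** * The observability theorem *)

Lemma mapof_continuous (R : realType) (n d : nat) (M : fmanifold R n)
    (N : fmanifold R d) (G : lie_group R) (aM : action G M) (aN : action G N)
    (k : nat) (alpha : R) (cond : set (M -> N)) (rep : M -> N)
    (HH : map_manifold aM aN k alpha cond rep) (f : HH) x :
  {for x, continuous (mapof f)}.
Proof.
have : range (@mapof _ _ _ _ _ _ _ _ _ _ _ _ HH) (mapof f) by exists f.
by rewrite mapof_range => -[[fc _] _ _ _]; exact: fc.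
Qed.

Theorem theorem5p25 (R : realType)
  (* the cohomogeneity-one manifold and the normalizing curve *)
  (n : nat) (M : fmanifold R n) (G : lie_group R) (aM : action G M)
  (q : M -> R) (gam : R -> M) (L : R)
  (hM : compact [set: M]) (hq : cohomogeneity_one aM q)
  (hgam : joins_ends q gam L)
  (* the target *)
  (d : nat) (N : fmanifold R d) (aN : action G N) (h : tensor2 N)
  (hN : compact [set: N]) (hh : smooth_metric h) (haN : invariant_metric aN h)
  (* the spaces of metrics, of maps and of sections *)
  (k : nat) (alpha : R) (hk : (4 <= k)%N) (halpha : 0 < alpha < 1)
  (GG : metric_manifold aM gam L k alpha)
  (cond : set (M -> N)) (rep : M -> N)
  (HH : map_manifold aM aN k.+2 alpha cond rep)
  (YY : section_bundle aM aN k alpha (mapof (m:=HH)))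
  (hF : F_smooth h GG YY)
  (* the Einstein family *)
  (lambda : R) (hlambda : 0 < lambda)
  (m : nat) (S : fmanifold R m) (p0 : S) (gS : S -> GG)
  (hgS : smooth_map S GG setT gS) (hfam : smooth_family gS)
  (hEin : forall p, smooth_metric (met (gS p)) /\ einstein lambda (met (gS p)))
  (* the reference harmonic map, its nondegeneracy and the harmonic branch *)
  (f0 : HH) (hf0 : Ften h (gS p0) f0 = cst 0)
  (hJ : blin_iso (jacobi h YY (gS p0) f0 (gS p0) f0))
  (S0 : set S) (Pi : S -> HH) (hPi : harmonic_branch h YY gS p0 f0 S0 Pi)
  (* a basis of the tangent space of S at p0 *)
  (e : m.-tuple 'rV[R]_m) (he : basis_of fullv e) :
  let A := core_package h YY gS p0 f0 Pi in
  let D := universal_response h YY gS p0 f0 Pi in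
  let J := jacobi_response h YY gS p0 f0 Pi in
  let B (Lam : 'I_m -> blin (opJ YY) R) : 'M[R]_m :=
    \matrix_(i, j) Lam i (J (tnth e j)) in
  (forall Lam : 'I_m -> blin (opJ YY) R, \det (B Lam) != 0 ->
    [/\ injective J,
        infinitesimally_observable h YY gS p0 f0 Pi,
        forall E : rich_class (A p0) (range D),
          detected_by p0 A (rich_scalar E) S0,
        detected_by p0 A (local_smooth_scalar (A p0)) S0
      & locally_embedded p0 A S0]) /\
  (injective J -> exists Lam : 'I_m -> blin (opJ YY) R, \det (B Lam) != 0).
Proof.
move=> A D J B.
have oS0 := hb_open hPi; have S0p0 := hb_in hPi.
have sA : smooth_map S (vchart (Xcore YY)) S0 A.
  exact: (core_smooth hF hgS hPi).
have [_ +] := response_diff hF hgS hPi; rewrite -/A -/D => DE.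
have DJ : forall v, (D v).1 = J v by exact: (response_fst hF hgS hPi).
(* [J] is given as a bare function; [Jb] has the same values and is a bounded operator. *)
pose Jb := bcomp (bfst _ _) (dop (A \o cinv p0) (chart p0 p0)).
have JE v : Jb v = J v by rewrite -DJ DE.
have BE Lam : B Lam = \matrix_(i, j) Lam i (Jb (tnth e j)).
  by apply/matrixP => i j; rewrite !mxE JE.
split=> [Lam detB|Ji]; last first.
  have [v w|T T0|Lam detB] := exists_det_pairing (J := Jb) he.
  - by rewrite !JE; exact: Ji.
  (* A nonzero operator is nonzero at some [x]; evaluation at [x] followed by a functional on the
     section space then detects it. *)
  - have [x Tx] : exists x, T x != 0.
      apply: contrapT => Tx; move/eqP: T0; apply; apply: blin_ext => x.
      by apply: contrapT => /eqP Tx0; apply: Tx; exists x.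
    have [l lT] := section_functional
      (@mapof_continuous _ _ _ _ _ _ _ _ _ _ _ _ HH f0)
      (triv_iso (tdom_in YY f0)) Tx.
    by exists (bcomp l (flip (bid (opJ YY)) x)).
  - by exists Lam; rewrite BE.
have key v : (forall i, Lam i (J v) = 0) -> v = 0.
  move=> Lv; rewrite BE in detB; apply: (det_pairing he detB) => i.
  by rewrite JE.
have Ji : injective J.
  move=> v w vw; apply/eqP; rewrite -subr_eq0; apply/eqP/key => i.
  have JB : Jb (v - w) = Jb v - Jb w by rewrite linearB.
  by rewrite -JE JB !JE vw subrr linear0.
have Di : injective D by move=> v w vw; apply: Ji; rewrite -!DJ vw.
(* Only the differentials on the range of [D] enter, so the same argument serves rich classes and
   all smooth scalars. *)
have detect (psi : 'I_m -> Xcore YY -> R) (U : set (Xcore YY)) :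
    open U -> U (A p0) -> (forall i, smooth_on U (psi i)) ->
    (forall i v, 'd (psi i) (A p0) (D v) = Lam i (J v)) ->
    let Psi p : 'rV[R]_m := \row_i psi i (A p) in
    injective (tmap (Psi : S -> vchart 'rV[R]_m) p0) /\
    exists2 S1 : set S, [/\ open S1, S1 p0 & S1 `<=` S0 `&` A @^-1` U]
      & diffeo_onto_open S1 Psi.
  move=> oU Ua0 sU dpsi; apply: (detection oS0 S0p0 sA oU Ua0 sU) => v psi0.
  by apply: key => i; rewrite -dpsi DE.
pose lam i : Xcore YY -> R := Lam i \o fst.
have slam i : smooth_on setT (lam i).
  by move=> r; exact: (Cn_blin r (bcomp (Lam i) (bfst _ _)) openT).
have dlam i v : 'd (lam i) (A p0) (D v) = Lam i (J v).
  pose T := bcomp (Lam i) (bfst (opJ YY) (opG YY)).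
  apply: etrans (esym (dopE (blin_differentiable T (A p0)) (D v))) _.
  by rewrite (dop_blin T (A p0)) /= DJ.
have [lam_inj [S1 [oS1 S1p0 S1S] S1d]] :=
  detect lam setT openT I slam dlam.
split=> //.
- move=> E.
  (* Surjectivity of the restriction map provides members of [E] with the same differentials as the
     [lam i] on the range of [D]. *)
  have /choice[s sP] : forall i, exists s : rc_space E,
      forall x, range D x -> 'd (rc_fun s) (A p0) x = lam i x.
    move=> i; apply: rc_restr_surjective => [b x y _ _|].
      by rewrite /lam/= linearP.
    exists `|Lam i| => x _; rewrite (le_trans (blin_ge _ _))// ler_wpM2l//.
    by rewrite prod_normE le_max lexx.
  have [||||psi_inj [S2 [oS2 S2p0 S2S] S2d]] :=
    detect (fun i => rc_fun (s i)) (rc_dom E).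
  + exact: rc_open.
  + exact: rc_in.
  + by move=> i; exact: rc_smooth.
  + by move=> i v; rewrite sP; [rewrite /lam/= DJ|exists v].
  exists (fun i => rc_fun (s i)); split=> //; first by move=> i; exists (s i).
  by exists S2; [split=> // p /S2S[]|].
- exists lam; split=> //.
    by move=> i; exists setT; [split=> //; exact: openT|exact: slam].
  by exists S1; [split=> // p /S1S[]|].
(* The coordinates built from the [lam i] factor through [A], and the [lam i] are smooth on the
   whole operator space. *)
- exists S1; first by split=> // p /S1S[].
  apply: (embedding_of_factor sA openT (psi := fun x => \row_i lam i x)) => //.
  by move=> r; exact: Cn_row openT (fun i => slam i r).
Qed.
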